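(* Let $I,\Omega\subseteq\mathbb{R}$ be nonempty, where $I$ is an interval in $\mathbb{R}$, and let $\{\phi_k: k\in\mathbb{Z}\}$ be an orthonormal basis of $L^2(I)$. Suppose that $\{S_k: k\in\mathbb{Z}\}$ is a sequence of functions $S_k:\Omega\to\mathbb{C}$, that $\mathbf{t}:=\{t_k\in\mathbb{R}: k\in\mathbb{Z}\}$ is a numerical sequence in $\Omega$, and that the averaging function $h(t)$ is compactly supported in $L^1(\mathbb{R})$, satisfying the conditions D1. $(S_k\star h)(t_l)=a_k\delta_{kl}$ for $(k,l)\in\mathbb{Z}\times\mathbb{Z}$, where $a_k\neq 0$; D2. $\sum_{k\in\mathbb{Z}}|S_k(t)|^2<\infty$ for each $t\in\Omega$. Define a function $K:I\times\Omega\to\mathbb{C}$ by $$K(x,t):=\sum_{k\in\mathbb{Z}}S_k(t)\,\overline{\phi_k(x)},$$ and a linear integral transform $T$ on $L^2(I)$ by $$(TF)(t):=\int_I F(x)K(x,t)\,dx .$$ Then $T$ is well defined and injective. Furthermore, if the range of $T$ is denoted by $$\mathcal{H}:=\Big\{f:\Omega\to\mathbb{C} \,:\, f(t)=\int_I F(x)K(x,t)\,dx,\ F\in L^2(I)\Big\},$$ then: (i) $(\mathcal{H},\langle\cdot,\cdot\rangle_{\mathcal{H}})$ is a Hilbert space isometrically isomorphic to $L^2(I)$, i.e. $\mathcal{H}\cong L^2(I)$, when endowed with the inner product $\langle f,g\rangle_{\mathcal{H}}:=\langle F,G\rangle_{L^2(I)}$, where $f(t)=(TF)(t)=\int_I F(x)K(x,t)\,dx$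 and $g(t)=(TG)(t)=\int_I G(x)K(x,t)\,dx$. (ii) $\{S_k: k\in\mathbb{Z}\}$ is an orthonormal basis for $\mathcal{H}$. (iii) Each function $f\in\mathcal{H}$ can be recovered from its samples on the sequence $\{t_k: k\in\mathbb{Z}\}$ via the formula $$f(t)=\sum_{k\in\mathbb{Z}}(f\star h)(t_k)\,\frac{S_k(t)}{a_k}.$$ This series converges absolutely and uniformly on subsets of $\Omega$ where $\|K(\cdot,t)\|_{L^2(I)}$ is bounded.
   Context: Convolution is $(f\star h)(s)=\int_{-\infty}^{\infty}f(t)h(s-t)\,dt$. $\delta_{kl}$ is the Kronecker delta.
   Formalization: It is additionally assumed that the averages (f⋆h)(t_l) exist as Lebesgue integrals for every f in the range of T and every l (f extended by 0 outside Ω); without this, T can fail to be injective. *)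

(* Defs.v *)
From HB Require Import structures.
From mathcomp Require Import all_boot all_order all_algebra finmap.
From mathcomp Require Import complex.
From mathcomp Require Import all_classical all_reals all_analysis.
From mathcomp Require summability.
Set Implicit Arguments.
Unset Strict Implicit.
Unset Printing Implicit Defensive.
Import Order.TTheory GRing.Theory Num.Theory.
Import numFieldNormedType.Exports.
Local Open Scope classical_set_scope.
Local Open Scope ring_scope.

Notation normc := ComplexField.Normc.normc.
Notation totally := (@summability.totally int).

(* A (semi-)inner product space is a set [H] of vectors of an ambient
   [R[i]]-module together with a form [ip], linear in its first argument.
   Nothing below assumes [ip f f = 0 -> f = 0], so that the notions also apply
   to L^2(I) presented by functions rather than by classes of functions. *)
Section InnerProduct.
Variables (R : realType) (V : lmodType R[i]).
Implicit Types (H : set V) (ip : V -> V -> R[i]).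

Definition ipnorm ip (f : V) : R := Num.sqrt (complex.Re (ip f f)).

(* Norm convergence of the net of finite partial sums: the sum does not depend
   on an enumeration of the integers. *)
Definition has_sum ip (v : int -> V) (s : V) : Prop :=
  (fun A : {fset int} => ipnorm ip (s - \sum_(k <- A) v k)) @ totally
    --> (0 : R).

Definition orthonormal_basis H ip (e : int -> V) : Prop :=
  [/\ forall k, H (e k),
      forall k l, ip (e k) (e l) = (k == l)%:R
    & forall f, H f -> forall eps : R, 0 < eps ->
      exists (A : {fset int}) (c : int -> R[i]),
        ipnorm ip (f - \sum_(k <- A) c k *: e k) < eps].

Definition linear_subspace H : Prop :=
  H 0 /\ forall (c : R[i]) f g, H f -> H g -> H (c *: f + g).

Definition inner_product H ip : Prop :=
  [/\ forall (c : R[i]) f g k, H f -> H g -> H k ->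
        ip (c *: f + g) k = c * ip f k + ip g k,
      forall f g, H f -> H g -> ip g f = conjc (ip f g)
    & forall f, H f -> f != 0 -> 0 < ip f f].

Definition ip_complete H ip : Prop :=
  forall u : nat -> V, (forall n, H (u n)) ->
    (forall eps : R, 0 < eps -> exists N : nat, forall m n,
       (N <= m)%N -> (N <= n)%N -> ipnorm ip (u m - u n) < eps) ->
    exists2 f, H f & (fun n => ipnorm ip (u n - f)) @ \oo --> (0 : R).

Definition hilbert_space H ip : Prop :=
  [/\ linear_subspace H, inner_product H ip & ip_complete H ip].

End InnerProduct.

(* Through the quotients by null vectors, [T] is then a linear isometric
   bijection. *)
Definition isometric_isomorphism (R : realType) (V W : lmodType R[i])
    (H : set V) (ipH : V -> V -> R[i]) (G : set W) (ipG : W -> W -> R[i])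
    (T : V -> W) : Prop :=
  [/\ forall (c : R[i]) f g, H f -> H g -> T (c *: f + g) = c *: T f + T g,
      T @` H = G
    & forall f g, H f -> H g -> ipG (T f) (T g) = ipH f g].

Section ComplexIntegration.
Variable R : realType.
Local Notation mu := (@lebesgue_measure R).

Definition cintegrable (D : set R) (f : R -> R[i]) : Prop :=
  mu.-integrable D (fun x => (complex.Re (f x))%:E) /\
  mu.-integrable D (fun x => (complex.Im (f x))%:E).

Definition cintegral (D : set R) (f : R -> R[i]) : R[i] :=
  Complex (\int[mu]_(x in D) complex.Re (f x))
          (\int[mu]_(x in D) complex.Im (f x)).

Definition L2 (D : set R) : set (R -> R[i]) := [set f : R -> R[i] |
  [/\ measurable_fun D (fun x => complex.Re (f x)),
      measurable_fun D (fun x => complex.Im (f x))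
    & (\int[mu]_(x in D) ((normc (f x)) ^+ 2)%:E < +oo)%E]].

Definition ipL2 (D : set R) (f g : R -> R[i]) : R[i] :=
  cintegral D (fun x => f x * conjc (g x)).

(* The element of L^1(R) represented by [f] has compact (essential) support. *)
Definition compactly_supported (f : R -> R[i]) : Prop :=
  exists2 C : set R, compact C & {ae mu, forall x, ~ C x -> f x = 0}.

End ComplexIntegration.

Section Convolution.
Variables (R : realType) (Omega : set R).

(* A function on [Omega] is convolved through its extension by 0 to the real
   line.  The extension plays no role when [s - supp h] is included in
   [Omega]. *)
Definition conv_integrand (f : Omega -> R[i]) (h : R -> R[i]) (s : R) :
    R -> R[i] :=
  fun t => 'valL_ 0 f t * h (s - t).

(* [cintegrable] requires Borel measurability; functions on [Omega] are only
   expected to give Lebesgue measurable integrands, i.e. integrands equal a.e. to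
   a Borel function.  The library integral of such an integrand, a supremum over
   simple functions, is its Lebesgue integral. *)
Definition conv_exists (f : Omega -> R[i]) (h : R -> R[i]) (s : R) : Prop :=
  exists2 g : R -> R[i], cintegrable [set: R] g &
    conv_integrand f h s = g %[ae @lebesgue_measure R].

Definition convolution (f : Omega -> R[i]) (h : R -> R[i]) (s : R) : R[i] :=
  cintegral [set: R] (conv_integrand f h s).

End Convolution.

Section Transform.
Variables (R : realType) (I Omega : set R).
Variables (phi : int -> R -> R[i]) (S : int -> Omega -> R[i]).

(* [k] represents K(., t): the series converges to it in L^2(I). *)
Definition is_kernel_at (t : Omega) (k : R -> R[i]) : Prop :=
  L2 I k /\ has_sum (@ipL2 R I) (fun j x => S j t * conjc (phi j x)) k.

(* [samp_kernel t x] is K(x, t), for some representative of the sum of the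
   series (and 0 should the series diverge). *)
Definition samp_kernel (t : Omega) : R -> R[i] := xget 0 (is_kernel_at t).

Definition transform (F : R -> R[i]) : Omega -> R[i] :=
  fun t => cintegral I (fun x => F x * samp_kernel t x).

Definition range_space : set (Omega -> R[i]) := transform @` L2 I.

(* <f, g> := <F, G>, for preimages F and G of f and g chosen in L^2(I). *)
Definition preimage_of (f : Omega -> R[i]) : R -> R[i] :=
  xget 0 [set F : R -> R[i] | L2 I F /\ transform F = f].

Definition range_ip (f g : Omega -> R[i]) : R[i] :=
  ipL2 I (preimage_of f) (preimage_of g).

(* K(., t) exists for every t, and the integral defining (TF)(t) exists and does
   not depend on the representatives of F and K(., t). *)
Definition transform_well_defined : Prop :=
  (forall t, exists k, is_kernel_at t k) /\
  (forall t k F G, is_kernel_at t k -> L2 I F -> L2 I G ->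
     F = G %[ae @lebesgue_measure R in I] ->
     cintegrable I (fun x => G x * k x) /\
     transform F t = cintegral I (fun x => G x * k x)).

(* Injectivity on L^2(I), where functions equal a.e. on I are identified. *)
Definition transform_injective : Prop :=
  forall F G, L2 I F -> L2 I G -> transform F = transform G ->
    F = G %[ae @lebesgue_measure R in I].

End Transform.

(* Main.v *)
Require Import Defs.
From HB Require Import structures.
From mathcomp Require Import all_boot all_order all_algebra finmap.
From mathcomp Require Import complex.
From mathcomp Require Import all_classical all_reals all_analysis.
From mathcomp Require Import ring lra measurable_realfun.
From mathcomp Require summability.
Set Implicit Arguments.
Unset Strict Implicit.
Unset Printing Implicit Defensive.
Import Order.TTheory GRing.Theory Num.Theory.
Import numFieldNormedType.Exports.
Local Open Scope classical_set_scope.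
Local Open Scope ring_scope.

(* Write [F_k = <F, phi_k>].  Then [(TF)(t) = <F, conj K(., t)> = sum_k F_k S_k(t)]
   pointwise, so everything follows once [((TF) * h)(t_l) = a_l F_l], that is, once
   convolution with [h] may be exchanged with the series.  The map
   [F |-> ((TF) * h)(t_l)] is linear, and agrees with [F |-> a_l F_l] on the basis by
   D1, so the point is its continuity.  By Fatou's lemma the seminorm
   [F |-> int |(TF)(t) h(t_l - t)| dt] is lower semicontinuous on [L^2(I)]; it is
   finite, hence bounded by Baire's argument.  Injectivity of [T] is then immediate,
   and [T] transports the Hilbert space structure and the basis of [L^2(I)]. *)

(* The obstacle is that the series for [TF] cannot simply be integrated term by term: D2 bounds
   [sum_k |S_k(t)|^2] at each [t] separately and supplies no majorant integrable against
   [h (t_l - t)]. Two facts are available instead. By Cauchy-Schwarz [|TF (t)|] is at most the norm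
   of [F] times that of [K(., t)], so norm convergence in [L^2(I)] gives convergence of the
   integrands at every point, as Fatou requires; and each single integral is finite by [H_conv],
   which completeness upgrades to a uniform bound. Since [L^2(I)] consists of functions, its form is
   only semi-definite: the Hilbert space lemmas tolerate null vectors, which for [L^2(I)] are the
   functions vanishing a.e. Since the integrand of a convolution is only a.e. equal to a Borel
   function, integrals are compared with those of Borel representatives. *)
#[local] Existing Instance summability.totally_filter.

(** * Modulus, real part and imaginary part of complex numbers *)

Section Normc.
Variable R : realType.
Implicit Types z w : R[i].

Lemma normc_ge0 z : 0 <= normc z.
Proof. by case: z => a b; exact: sqrtr_ge0. Qed.

Lemma sqr_normcE z : normc z ^+ 2 = complex.Re z ^+ 2 + complex.Im z ^+ 2.
Proof. by case: z => a b; rewrite sqr_sqrtr// addr_ge0// sqr_ge0. Qed.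

Lemma mul_conjcE z : z * conjc z = ((normc z ^+ 2)%:C)%C.
Proof.
rewrite sqr_normcE; case: z => a b; apply/eqP; rewrite eq_complex/=.
by apply/andP; split; apply/eqP; ring.
Qed.

Lemma normc_conjc z : normc (conjc z) = normc z.
Proof. by case: z => a b /=; rewrite sqrrN. Qed.

Lemma normc_real (x : R) : normc (x%:C)%C = `|x|.
Proof. by rewrite /= expr0n/= addr0 sqrtr_sqr. Qed.

Lemma Re_le_normc z : `|complex.Re z| <= normc z.
Proof.
case: z => a b /=; rewrite -sqrtr_sqr ler_sqrt ?addr_ge0 ?sqr_ge0//.
by rewrite lerDl sqr_ge0.
Qed.

Lemma Im_le_normc z : `|complex.Im z| <= normc z.
Proof.
case: z => a b /=; rewrite -sqrtr_sqr ler_sqrt ?addr_ge0 ?sqr_ge0//.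
by rewrite lerDr sqr_ge0.
Qed.

Lemma normc_le_ReIm z : normc z <= `|complex.Re z| + `|complex.Im z|.
Proof.
rewrite -(@ler_pXn2r _ 2)// ?nnegrE ?normc_ge0 ?addr_ge0//.
rewrite sqr_normcE sqrrD !real_normK ?num_real// lerD2r lerDl.
by rewrite mulrn_wge0// mulr_ge0.
Qed.

Lemma ReD z w : complex.Re (z + w) = complex.Re z + complex.Re w.
Proof. by case: z; case: w. Qed.

Lemma ImD z w : complex.Im (z + w) = complex.Im z + complex.Im w.
Proof. by case: z; case: w. Qed.

Lemma ReN z : complex.Re (- z) = - complex.Re z.
Proof. by case: z. Qed.

Lemma ImN z : complex.Im (- z) = - complex.Im z.
Proof. by case: z. Qed.

Lemma ReM z w :
  complex.Re (z * w) = complex.Re z * complex.Re w - complex.Im z * complex.Im w.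
Proof. by case: z; case: w. Qed.

Lemma ImM z w :
  complex.Im (z * w) = complex.Re z * complex.Im w + complex.Im z * complex.Re w.
Proof. by case: z; case: w. Qed.

Lemma Re_conjc z : complex.Re (conjc z) = complex.Re z.
Proof. by case: z. Qed.

Lemma Im_conjc z : complex.Im (conjc z) = - complex.Im z.
Proof. by case: z. Qed.

Lemma complex_eqP z w :
  complex.Re z = complex.Re w -> complex.Im z = complex.Im w -> z = w.
Proof. by case: z; case: w => /= ? ? ? ? -> ->. Qed.

Lemma ler_normcD z w : normc (z + w) <= normc z + normc w.
Proof. exact: (ler_normD (z : Rcomplex R) w). Qed.

Lemma normcN z : normc (- z) = normc z.
Proof. exact: (normrN (z : Rcomplex R)). Qed.

Lemma normc_eq0 z : normc z = 0 -> z = 0.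
Proof. exact: ComplexField.Normc.eq0_normc. Qed.

Lemma normcM z w : normc (z * w) = normc z * normc w.
Proof. exact: ComplexField.Normc.normcM. Qed.

End Normc.

(** * Finite and unconditional sums indexed by the integers *)

Section Totally.

Lemma totally_cvg0P (R : realType) (F : {fset int} -> R) :
  F @ totally --> (0 : R) <->
  forall eps : R, 0 < eps -> exists A : {fset int},
    forall B : {fset int}, (A `<=` B)%fset -> `|F B| < eps.
Proof.
split=> [/cvgrPdist_lt/= F0 eps eps0|F0].
  have [A _ AP] := F0 eps eps0.
  by exists A => B AB; have := AP B AB; rewrite /= sub0r normrN.
apply/cvgrPdist_lt => eps /F0 [A AP].
by exists A => // B AB; rewrite /= sub0r normrN; exact: AP.
Qed.

End Totally.

Lemma sum_fsetU (V : nmodType) (A B : {fset int}) (v : int -> V) :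
  [disjoint A & B]%fset ->
  \sum_(k <- (A `|` B)%fset) v k = \sum_(k <- A) v k + \sum_(k <- B) v k.
Proof.
move=> /fdisjointP AB; rewrite -big_cat; apply: perm_big; apply: uniq_perm => //.
  rewrite cat_uniq !fset_uniq andbT/=; apply/hasPn => k kB.
  by apply: contraL kB => /AB.
by move=> k; rewrite mem_cat !inE.
Qed.

Lemma sum_fset_sub (V : nmodType) (A B : {fset int}) (v : int -> V) :
  (A `<=` B)%fset ->
  \sum_(k <- B) v k = \sum_(k <- A) v k + \sum_(k <- (B `\` A)%fset) v k.
Proof.
move=> /fsubsetP AB; rewrite -sum_fsetU; last first.
  by apply/fdisjointP => k kA; rewrite inE kA.
congr (\sum_(k <- enum_fset _) v k); apply/fsetP => k; rewrite !inE.
by case: (boolP (k \in A)) => // /AB ->.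
Qed.

Section EsumFinite.
Variables (R : realType) (u : int -> R).
Hypothesis u_ge0 : forall k, 0 <= u k.

Lemma esum_le_finP (M : R) :
  (\esum_(k in [set: int]) (u k)%:E <= M%:E)%E <->
  forall B : {fset int}, \sum_(k <- B) u k <= M.
Proof.
have sumE (B : {fset int}) :
    (\sum_(k \in [set` B]) (u k)%:E = (\sum_(k <- B) u k)%:E)%E.
  by rewrite fsbig_finite//= set_fsetK sumEFin.
split=> [le_M B|le_M].
  rewrite -lee_fin -sumE; apply: le_trans le_M.
  by apply: ereal_sup_ubound; exists [set` B] => //; split.
apply: ge_ereal_sup => _ [X [finX _] <-].
by rewrite -(fset_setK finX) sumE lee_fin.
Qed.

Lemma esum_fin_bounded : (\esum_(k in [set: int]) (u k)%:E < +oo)%E ->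
  exists M : R, forall B : {fset int}, \sum_(k <- B) u k <= M.
Proof.
move=> u_fin; exists (fine (\esum_(k in [set: int]) (u k)%:E)%E).
apply/esum_le_finP; rewrite fineK// ge0_fin_numE// esum_ge0// => k _.
by rewrite lee_fin.
Qed.

(** A finite [A] whose partial sum is within [eps] of the supremum works: adding a disjoint [B]
    cannot exceed the supremum. *)
Lemma esum_fin_tail (eps : R) : 0 < eps ->
  (\esum_(k in [set: int]) (u k)%:E < +oo)%E ->
  exists A : {fset int}, forall B : {fset int}, [disjoint A & B]%fset ->
    \sum_(k <- B) u k < eps.
Proof.
move=> eps0 u_fin.
pose E := [set \sum_(k <- B) u k | B in [set: {fset int}]].
have supE : has_sup E.
  split; first by exists (\sum_(k <- fset0) u k), fset0.
  by have [M MP] := esum_fin_bounded u_fin; exists M => _ [B _ <-].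
have [_ [A _ <-] ltA] := sup_adherent eps0 supE.
exists A => B AB.
have : \sum_(k <- (A `|` B)%fset) u k <= sup E.
  by apply: sup_upper_bound => //; exists (A `|` B)%fset.
rewrite sum_fsetU//; lra.
Qed.

End EsumFinite.

(** * Semi-inner product spaces *)

(** Positivity without definiteness, so that [L^2(I)] presented by functions qualifies. *)
Definition semi_inner_product (R : realType) (V : lmodType R[i]) (H : set V)
    (ip : V -> V -> R[i]) : Prop :=
  [/\ linear_subspace H,
      forall (c : R[i]) f g k, H f -> H g -> H k ->
        ip (c *: f + g) k = c * ip f k + ip g k,
      forall f g, H f -> H g -> ip g f = conjc (ip f g)
    & forall f, H f -> 0 <= ip f f].

Section SemiInnerProduct.
Variables (R : realType) (V : lmodType R[i]) (H : set V).
Variable ip : V -> V -> R[i].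
Hypothesis sip : semi_inner_product H ip.

Let N f := ipnorm ip f.

Lemma subspace0 : H 0.
Proof. by case: sip => -[]. Qed.

Lemma subspaceZD c f g : H f -> H g -> H (c *: f + g).
Proof. by case: sip => -[_ +] _ _ _; apply. Qed.

Lemma subspaceD f g : H f -> H g -> H (f + g).
Proof. by rewrite -{2}[f]scale1r; exact: subspaceZD. Qed.

Lemma subspaceZ c f : H f -> H (c *: f).
Proof. by rewrite -[c *: f]addr0 => Hf; exact: subspaceZD subspace0. Qed.

Lemma subspaceB f g : H f -> H g -> H (f - g).
Proof. by move=> Hf Hg; rewrite addrC -scaleN1r; exact: subspaceZD. Qed.

Lemma subspace_sum (I : eqType) (A : seq I) (v : I -> V) :
  (forall k, k \in A -> H (v k)) -> H (\sum_(k <- A) v k).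
Proof.
move=> Hv; rewrite big_seq; apply: big_ind => //; first exact: subspace0.
by move=> x y Hx Hy; exact: subspaceD.
Qed.

Lemma ip_lin c f g k : H f -> H g -> H k ->
  ip (c *: f + g) k = c * ip f k + ip g k.
Proof. by case: sip => _ + _ _; apply. Qed.

Lemma ip_conj f g : H f -> H g -> ip g f = conjc (ip f g).
Proof. by case: sip => _ _ + _; apply. Qed.

Lemma ip_ge0 f : H f -> 0 <= ip f f.
Proof. by case: sip => _ _ _; apply. Qed.

Lemma ip0l g : H g -> ip 0 g = 0.
Proof.
move=> Hg; have := ip_lin 1 subspace0 subspace0 Hg.
by rewrite scaler0 addr0 mul1r => /eqP; rewrite -[X in X == _]addr0 -subr_eq0
  opprD addrACA subrr add0r sub0r oppr_eq0 => /eqP.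
Qed.

Lemma ipDl f g k : H f -> H g -> H k -> ip (f + g) k = ip f k + ip g k.
Proof. by move=> *; rewrite -[f in LHS]scale1r ip_lin// mul1r. Qed.

Lemma ipZl c f k : H f -> H k -> ip (c *: f) k = c * ip f k.
Proof.
by move=> Hf Hk; rewrite -[c *: f]addr0 ip_lin ?ip0l ?addr0//; exact: subspace0.
Qed.

Lemma ipBl f g k : H f -> H g -> H k -> ip (f - g) k = ip f k - ip g k.
Proof. by move=> *; rewrite addrC -scaleN1r ip_lin// mulN1r addrC. Qed.

Lemma ipDr f g k : H f -> H g -> H k -> ip k (f + g) = ip k f + ip k g.
Proof.
move=> Hf Hg Hk; rewrite ip_conj ?ipDl ?rmorphD/= -?ip_conj//.
exact: subspaceD.
Qed.

Lemma ipZr c f k : H f -> H k -> ip k (c *: f) = conjc c * ip k f.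
Proof.
move=> Hf Hk; rewrite ip_conj ?ipZl ?rmorphM/= -?ip_conj//.
exact: subspaceZ.
Qed.

Lemma ip_suml (A : seq int) (v : int -> V) g : (forall k, H (v k)) -> H g ->
  ip (\sum_(k <- A) v k) g = \sum_(k <- A) ip (v k) g.
Proof.
move=> Hv Hg; elim: A => [|k A IH]; first by rewrite !big_nil ip0l.
by rewrite !big_cons ipDl ?IH//; apply: subspace_sum.
Qed.

Lemma ip_sumr (A : seq int) (v : int -> V) g : (forall k, H (v k)) -> H g ->
  ip g (\sum_(k <- A) v k) = \sum_(k <- A) ip g (v k).
Proof.
move=> Hv Hg; rewrite ip_conj ?ip_suml ?rmorph_sum//=.
  by apply: eq_bigr => k _; rewrite -ip_conj.
by apply: subspace_sum.
Qed.

Lemma ipnorm_ge0 f : 0 <= N f.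
Proof. exact: sqrtr_ge0. Qed.

Lemma ipE f : H f -> ip f f = ((N f ^+ 2)%:C)%C.
Proof.
move=> /ip_ge0; rewrite lecE => /andP[/eqP/= Im0 Re0].
by rewrite sqr_sqrtr//; apply: complex_eqP.
Qed.

Lemma sqr_ipnorm f : H f -> N f ^+ 2 = complex.Re (ip f f).
Proof. by move=> /ipE ->. Qed.

Lemma ipnorm0 : N 0 = 0.
Proof. by rewrite /N /ipnorm ip0l ?sqrtr0//; exact: subspace0. Qed.

Lemma sqr_ipnormD f g : H f -> H g ->
  N (f + g) ^+ 2 = N f ^+ 2 + complex.Re (ip f g) *+ 2 + N g ^+ 2.
Proof.
move=> Hf Hg; rewrite !sqr_ipnorm//; last exact: subspaceD.
rewrite ipDl ?ipDr//; last exact: subspaceD.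
rewrite (ip_conj Hf Hg) !ReD Re_conjc; ring.
Qed.

Lemma ipnormZ c f : H f -> N (c *: f) = normc c * N f.
Proof.
move=> Hf; apply/eqP; rewrite -(@eqrXn2 _ 2)// ?ipnorm_ge0//; last first.
  by rewrite mulr_ge0 ?normc_ge0// ipnorm_ge0.
rewrite sqr_ipnorm; last exact: subspaceZ.
rewrite ipZl ?ipZr//; last exact: subspaceZ.
by rewrite mulrA mul_conjcE ipE// exprMn /= mulr0 subr0.
Qed.

Lemma ipnormN f : H f -> N (- f) = N f.
Proof.
by move=> Hf; rewrite -scaleN1r ipnormZ// normcN normc_real normr1 mul1r.
Qed.

Lemma ipnormBC f g : H f -> H g -> N (f - g) = N (g - f).
Proof. by move=> Hf Hg; rewrite -opprB ipnormN//; exact: subspaceB. Qed.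

(** The quadratic [t |-> N (f + t g) ^+ 2] in a real [t] is nonnegative, which constrains its
    coefficients; a real [t] sees only the real part of [ip f g]. *)
Lemma Re_ip_le f g : H f -> H g -> `|complex.Re (ip f g)| <= N f * N g.
Proof.
move=> Hf Hg.
have quad (t : R) :
    0 <= N f ^+ 2 + t * complex.Re (ip f g) *+ 2 + t ^+ 2 * N g ^+ 2.
  have HZ := subspaceZ (t%:C)%C Hg.
  have := sqr_ipnormD Hf HZ; rewrite ipZr// ipnormZ// normc_real exprMn.
  rewrite real_normK ?num_real// ReM /= oppr0 mul0r subr0 => <-.
  exact: sqr_ge0.
move: quad (ipnorm_ge0 f) (ipnorm_ge0 g).
move: (complex.Re _) (N f) (N g) => r a b quad a0 b0.
rewrite -(@ler_pXn2r _ 2)// ?nnegrE ?mulr_ge0// real_normK ?num_real//.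
have [b_eq0|b_neq0] := eqVneq b 0.
  have [->|r0] := eqVneq r 0; first by rewrite expr0n sqr_ge0.
  (* Here [g] is null and the quadratic is affine; this [t] would give it the value -1. *)
  have := quad (- (a ^+ 2 + 1) / (r *+ 2)); rewrite b_eq0.
  have -> : a ^+ 2 + - (a ^+ 2 + 1) / (r *+ 2) * r *+ 2 +
      (- (a ^+ 2 + 1) / (r *+ 2)) ^+ 2 * 0 ^+ 2 = -1 by field.
  by rewrite oppr_ge0 ler10.
(* The minimiser of the quadratic. *)
have := quad (- r / b ^+ 2).
have -> : a ^+ 2 + - r / b ^+ 2 * r *+ 2 + (- r / b ^+ 2) ^+ 2 * b ^+ 2 =
    ((a * b) ^+ 2 - r ^+ 2) / b ^+ 2 by field.
by rewrite pmulr_lge0 ?subr_ge0// invr_gt0 exprn_gt0// lt_neqAle eq_sym b_neq0.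
Qed.

(** Multiplying [f] by the phase [u] makes the form real and equal to the modulus of [ip f g], which
    reduces the claim to the bound on real parts. *)
Lemma ip_cauchy_schwarz f g : H f -> H g -> normc (ip f g) <= N f * N g.
Proof.
move=> Hf Hg; set z := ip f g.
have [z0|z0] := eqVneq (normc z) 0.
  by rewrite z0 mulr_ge0// ipnorm_ge0.
pose u := conjc z * ((normc z)^-1%:C)%C.
have nu : normc u = 1.
  rewrite normcM normc_conjc normc_real ger0_norm ?invr_ge0 ?normc_ge0//.
  by rewrite mulfV.
have := Re_ip_le (subspaceZ u Hf) Hg; rewrite ipnormZ// nu mul1r; apply: le_trans.
rewrite ipZl// -/z /u -mulrA mulrC -mulrA mul_conjcE ReM /= mul0r subr0.
by rewrite expr2 mulKf// ger0_norm// normc_ge0.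
Qed.

Lemma ipnormD f g : H f -> H g -> N (f + g) <= N f + N g.
Proof.
move=> Hf Hg; rewrite -(@ler_pXn2r _ 2)// ?nnegrE ?addr_ge0 ?ipnorm_ge0//.
rewrite sqr_ipnormD// sqrrD lerD2r lerD2l lerMn2r/=.
exact: le_trans (ler_norm _) (Re_ip_le Hf Hg).
Qed.

Lemma ipnorm_dist f g k : H f -> H g -> H k -> N (f - k) <= N (f - g) + N (g - k).
Proof.
move=> Hf Hg Hk; rewrite (_ : f - k = (f - g) + (g - k)).
  by apply: ipnormD; exact: subspaceB.
by rewrite addrA subrK.
Qed.

Lemma has_sum_ip (v : int -> V) s g : (forall k, H (v k)) -> H s -> H g ->
  has_sum ip v s ->
  (fun A : {fset int} => normc (ip s g - \sum_(k <- A) ip (v k) g)) @ totally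
    --> (0 : R).
Proof.
move=> Hv Hs Hg /totally_cvg0P vs; apply/totally_cvg0P => eps e0.
(* [N g] may vanish, hence the divisor [N g + 1]. *)
have g1 : 0 < N g + 1 by rewrite ltr_wpDl// ipnorm_ge0.
have [A AP] := vs (eps / (N g + 1)) (divr_gt0 e0 g1).
exists A => B /AP; rewrite ger0_norm ?ipnorm_ge0// => lt_eps.
rewrite ger0_norm ?normc_ge0// -ip_suml// -ipBl//; last exact: subspace_sum.
apply: le_lt_trans (ip_cauchy_schwarz _ Hg) _.
  by apply: subspaceB => //; exact: subspace_sum.
apply: (@le_lt_trans _ _ (N (s - \sum_(k <- B) v k) * (N g + 1))).
  by rewrite ler_wpM2l ?ipnorm_ge0// lerDl.
by rewrite -ltr_pdivlMr.
Qed.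

(** * Orthonormal families: Bessel, best approximation, expansions *)

Section Orthonormal.
Variable e : int -> V.
Hypothesis He : forall k, H (e k).
Hypothesis e_orth : forall k l, ip (e k) (e l) = (k == l)%:R.

Lemma ip_sum_orth (A : {fset int}) (c : int -> R[i]) l :
  ip (\sum_(k <- A) c k *: e k) (e l) = if l \in A then c l else 0.
Proof.
rewrite ip_suml// => [|k]; last exact: subspaceZ.
under eq_bigr do rewrite ipZl// e_orth mulr_natr mulrb.
case: ifPn => lA.
  rewrite (big_fsetD1 l)//= eqxx big_seq big1 ?addr0// => k.
  by rewrite !inE => /andP[/negPf-> _].
rewrite big_seq big1// => k kA; case: eqP => // kl.
by rewrite -kl kA in lA.
Qed.

Lemma sqr_ipnorm_sum (A : {fset int}) (c : int -> R[i]) :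
  N (\sum_(k <- A) c k *: e k) ^+ 2 = \sum_(k <- A) normc (c k) ^+ 2.
Proof.
have Hc k : H (c k *: e k) by exact: subspaceZ.
have Hs : H (\sum_(k <- A) c k *: e k) by exact: subspace_sum.
apply: (@complexI R); rewrite -ipE// {1}ip_suml// rmorph_sum/=.
rewrite [LHS]big_seq [RHS]big_seq; apply: eq_bigr => k kA.
by rewrite ipZl// ip_conj// ip_sum_orth kA mul_conjcE.
Qed.

(** Pythagoras: the residual of the Fourier sum over [A] is orthogonal to every [e k] with [k] in
    [A], hence to the difference of the two combinations. *)
Lemma sqr_ipnorm_approx (A : {fset int}) (c : int -> R[i]) f : H f ->
  N (f - \sum_(k <- A) c k *: e k) ^+ 2 =
  N (f - \sum_(k <- A) ip f (e k) *: e k) ^+ 2 +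
  \sum_(k <- A) normc (ip f (e k) - c k) ^+ 2.
Proof.
move=> Hf.
have Hs d : H (\sum_(k <- A) d k *: e k).
  by apply: subspace_sum => k _; exact: subspaceZ.
rewrite -sqr_ipnorm_sum.
rewrite (_ : f - _ = (f - \sum_(k <- A) ip f (e k) *: e k) +
    \sum_(k <- A) (ip f (e k) - c k) *: e k); last first.
  under [X in _ = _ + X]eq_bigr do rewrite scalerBl.
  by rewrite sumrB addrA subrK.
rewrite sqr_ipnormD//; last exact: subspaceB.
rewrite ip_sumr//; [|by move=> k; exact: subspaceZ|exact: subspaceB].
rewrite [X in complex.Re X]big_seq [X in complex.Re X]big1 ?mul0rn ?addr0// => k kA.
rewrite ipZr//; last exact: subspaceB.
by rewrite ipBl// ip_sum_orth kA subrr mulr0.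
Qed.

Lemma bessel (A : {fset int}) f : H f ->
  \sum_(k <- A) normc (ip f (e k)) ^+ 2 <= N f ^+ 2.
Proof.
move=> Hf; have := sqr_ipnorm_approx A (fun=> 0) Hf.
under eq_bigr do rewrite scale0r.
under [X in _ = _ + X -> _]eq_bigr do rewrite subr0.
by rewrite big1// subr0 => ->; rewrite lerDr sqr_ge0.
Qed.

(** Fourier coefficients give the best approximation over [B], and a combination over [A] is one
    over [B] with coefficients 0 off [A]. This turns a single good approximation into convergence of
    the net of Fourier sums. *)
Lemma ipnorm_approx_le (A B : {fset int}) (c : int -> R[i]) f :
  H f -> (A `<=` B)%fset ->
  N (f - \sum_(k <- B) ip f (e k) *: e k) <= N (f - \sum_(k <- A) c k *: e k).
Proof.
move=> Hf AB; rewrite -(@ler_pXn2r _ 2)// ?nnegrE ?ipnorm_ge0//.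
rewrite (_ : \sum_(k <- A) c k *: e k =
    \sum_(k <- B) (if k \in A then c k else 0) *: e k).
  by rewrite [leRHS]sqr_ipnorm_approx// lerDl sumr_ge0// => k _; rewrite sqr_ge0.
rewrite (sum_fset_sub _ AB) [X in _ + X]big_seq [X in _ + X]big1 ?addr0 => [|k].
  by apply: eq_big_seq => k ->.
by rewrite !inE => /andP[/negPf-> _]; rewrite scale0r.
Qed.

(** Once the finite set contains [l], the partial sum paired with [e l] is exactly [c l]; a nonzero
    gap would then be smaller than itself. *)
Lemma has_sum_coef c f l : H f -> has_sum ip (fun k => c k *: e k) f ->
  ip f (e l) = c l.
Proof.
move=> Hf sf; have Hc k : H (c k *: e k) by exact: subspaceZ.
have /totally_cvg0P lim := has_sum_ip Hc Hf (He l) sf.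
apply/eqP; rewrite -subr_eq0; apply: contraT => neq0.
have gt0 : 0 < normc (ip f (e l) - c l).
  rewrite lt_neqAle normc_ge0 eq_sym andbT.
  by apply: contra neq0 => /eqP/normc_eq0/eqP.
have [A /(_ (l |` A)%fset (fsubsetU1 _ _))] := lim _ gt0.
rewrite -ip_suml// ip_sum_orth fset1U1 ger0_norm ?normc_ge0//.
by rewrite ltxx.
Qed.

(** Limits in a seminorm are determined up to null vectors; in [L^2(I)] this is uniqueness a.e. *)
Lemma has_sum_unique v s s' : (forall k, H (v k)) -> H s -> H s' ->
  has_sum ip v s -> has_sum ip v s' -> N (s - s') = 0.
Proof.
move=> Hv Hs Hs' /totally_cvg0P vs /totally_cvg0P vs'.
apply/eqP; rewrite eq_le ipnorm_ge0 andbT; apply/ler_addgt0Pl => eps eps0.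
have eps20 : 0 < eps / 2 by rewrite divr_gt0.
have [[A AP] [B BP]] := (vs _ eps20, vs' _ eps20).
have Hsum : H (\sum_(k <- (A `|` B)%fset) v k) by exact: subspace_sum.
rewrite addr0; apply: le_trans (ipnorm_dist Hs Hsum Hs') _.
rewrite (splitr eps) lerD//.
  by apply/ltW/(le_lt_trans (ler_norm _))/AP/fsubsetUl.
rewrite ipnormBC//.
by apply/ltW/(le_lt_trans (ler_norm _))/BP/fsubsetUr.
Qed.

Hypothesis e_dense : forall f, H f -> forall eps : R, 0 < eps ->
  exists (A : {fset int}) (c : int -> R[i]), N (f - \sum_(k <- A) c k *: e k) < eps.

Lemma has_sum_onb f : H f -> has_sum ip (fun k => ip f (e k) *: e k) f.
Proof.
move=> Hf; apply/totally_cvg0P => eps /(e_dense Hf)[A [c lt_eps]].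
exists A => B AB; rewrite ger0_norm ?ipnorm_ge0//.
exact: le_lt_trans (ipnorm_approx_le c Hf AB) lt_eps.
Qed.

Lemma onb_complete f : H f -> (forall k, ip f (e k) = 0) -> N f = 0.
Proof.
move=> Hf f0; apply/eqP; rewrite eq_le ipnorm_ge0 andbT.
apply/ler_addgt0Pl => eps eps0; rewrite addr0.
have [A [c /ltW]] := e_dense Hf eps0; apply: le_trans.
have := ipnorm_approx_le c Hf (fsubset_refl A).
by rewrite big1 ?subr0// => k _; rewrite f0 scale0r.
Qed.

(** The functional kills finite combinations, which are dense, and its bound carries this to all of
    [H]. It serves for the difference of two functionals that agree on the basis. *)
Lemma bounded_functional_eq0 (L : V -> R[i]) (C : R) :
  (forall c f g, H f -> H g -> L (c *: f + g) = c * L f + L g) ->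
  (forall f, H f -> normc (L f) <= C * N f) -> (forall k, L (e k) = 0) ->
  forall f, H f -> L f = 0.
Proof.
move=> L_lin L_bnd Le0 f Hf.
have L0 : L 0 = 0.
  have := L_lin (-1) 0 0 subspace0 subspace0.
  by rewrite scaler0 addr0 mulN1r addNr.
have Ls (A : seq int) (c : int -> R[i]) : L (\sum_(k <- A) c k *: e k) = 0.
  elim: A => [|k A IH]; first by rewrite big_nil.
  rewrite big_cons L_lin// ?IH ?Le0 ?mulr0 ?addr0//.
  by apply: subspace_sum => j _; exact: subspaceZ.
have C1 : 0 < `|C| + 1 by rewrite ltr_wpDl.
apply/normc_eq0/eqP; rewrite eq_le normc_ge0 andbT; apply/ler_addgt0Pl => eps eps0.
have [A [c lt_eps]] := e_dense Hf (divr_gt0 eps0 C1); rewrite addr0.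
have Hs : H (\sum_(k <- A) c k *: e k).
  by apply: subspace_sum => j _; exact: subspaceZ.
have -> : L f = L (f - \sum_(k <- A) c k *: e k).
  by rewrite addrC -scaleN1r L_lin// Ls mulr0 add0r.
apply: le_trans (L_bnd _ (subspaceB Hf Hs)) _.
apply: (@le_trans _ _ ((`|C| + 1) * N (f - \sum_(k <- A) c k *: e k))).
  by rewrite ler_wpM2r ?ipnorm_ge0// (le_trans (ler_norm C))// lerDl.
by rewrite mulrC -ler_pdivlMr// ltW.
Qed.

End Orthonormal.

(** Completeness speaks of sequences while the sum is a net. Finite sets [A n] are therefore chosen
    beyond which partial sums move by less than [1 / (n + 1)]; the limit along the [A n] is then the
    limit of the net. *)
Lemma riesz_fischer e (c : int -> R[i]) : ip_complete H ip ->
  (forall k, H (e k)) -> (forall k l, ip (e k) (e l) = (k == l)%:R) ->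
  (\esum_(k in [set: int]) ((normc (c k)) ^+ 2)%:E < +oo)%E ->
  exists2 f, H f & has_sum ip (fun k => c k *: e k) f.
Proof.
move=> complH He e_orth c2.
pose s (X : {fset int}) := \sum_(k <- X) c k *: e k.
have Hs X : H (s X) by apply: subspace_sum => k _; exact: subspaceZ.
have [|A AP] := choice (_ : forall n : nat, exists A : {fset int},
    forall B : {fset int}, (A `<=` B)%fset -> N (s B - s A) < n.+1%:R^-1).
  move=> n; have n0 : 0 < (n.+1%:R^-1 : R) ^+ 2 by rewrite exprn_gt0// invr_gt0.
  have [|A AP] := esum_fin_tail _ n0 c2; first by move=> k; exact: sqr_ge0.
  exists A => B AB; rewrite -(@ltr_pXn2r _ 2)// ?nnegrE ?ipnorm_ge0 ?invr_ge0//.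
  have AB0 : [disjoint A & B `\` A]%fset by apply/fdisjointP => k kA; rewrite inE kA.
  rewrite /s (sum_fset_sub _ AB) addrC addKr (sqr_ipnorm_sum He e_orth).
  exact: AP.
have inv_le (m n : nat) : (m <= n)%N -> n.+1%:R^-1 <= m.+1%:R^-1 :> R.
  by move=> mn; rewrite lef_pV2 ?posrE// ler_nat.
have [eps eps0|f Hf] := complH (s \o A) (fun n => Hs (A n)).
  have eps20 : 0 < eps / 2 by rewrite divr_gt0.
  have [n nlt] := ltr_add_invr eps20; rewrite add0r in nlt.
  exists n => i j ni nj; rewrite (splitr eps).
  (* [A i] and [A j] need not be nested; both are compared with their union. *)
  apply: le_lt_trans (ipnorm_dist (Hs _) (Hs (A i `|` A j)%fset) (Hs _)) _.
  rewrite [X in X + _]ipnormBC// ltrD//.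
    by apply: lt_trans (AP _ _ (fsubsetUl _ _)) (le_lt_trans (inv_le _ _ ni) nlt).
  by apply: lt_trans (AP _ _ (fsubsetUr _ _)) (le_lt_trans (inv_le _ _ nj) nlt).
move=> /cvgrPdist_lt/= fP; exists f => //; apply/totally_cvg0P => eps eps0.
have eps20 : 0 < eps / 2 by rewrite divr_gt0.
have [n nlt] := ltr_add_invr eps20; rewrite add0r in nlt.
have [m _ mP] := fP _ eps20.
exists (A (maxn m n)) => B /AP ltB; rewrite ger0_norm ?ipnorm_ge0//.
apply: le_lt_trans (ipnorm_dist Hf (Hs (A (maxn m n))) (Hs B)) _.
rewrite (splitr eps) ltrD//.
  have := mP _ (leq_maxl m n); rewrite sub0r normrN ger0_norm ?ipnorm_ge0//.
  by rewrite ipnormBC.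
rewrite ipnormBC//; apply: lt_trans ltB _.
exact: le_lt_trans (inv_le _ _ (leq_maxr m n)) nlt.
Qed.

(** * Lower semicontinuous seminorms on a complete space *)

Section BoundedSeminorm.
Variable p : V -> R.
Hypothesis p_subadd : forall f g, H f -> H g -> p (f + g) <= p f + p g.
Hypothesis p_homog : forall (t : R) f, H f -> p ((t%:C)%C *: f) = `|t| * p f.
Hypothesis p_lsc : forall (M : R) f (u : nat -> V), H f -> (forall n, H (u n)) ->
  (fun n => N (u n - f)) @ \oo --> (0 : R) -> (forall n, p (u n) <= M) -> p f <= M.

(** Scaling gives a small [g] with [p g > M]. Since [2 * p g <= p (x + g) + p (x - g)], one of
    [x + g] and [x - g] also has [p] above [M]. *)
Lemma unbounded_seminorm_ball : (forall C : R, exists2 f, H f & C * N f < p f) ->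
  forall (M r : R) x, 0 < r -> H x -> exists y, [/\ H y, N (y - x) < r & M < p y].
Proof.
move=> unb M0 r x r0 Hx; pose M := Num.max M0 0.
have M_ge0 : 0 <= M by rewrite le_max lexx orbT.
have [g [Hg Ng pg]] : exists g, [/\ H g, N g < r & M < p g].
  (* With this constant, rescaling [f] to norm [r / 2] gives [p] a value above [M]. *)
  have [f Hf] := unb (M / (r / 2)).
  have [Nf0|Nf0] := eqVneq (N f) 0.
    (* Every multiple of a null vector lies in the ball; this one has [p] equal to [M + 1]. *)
    rewrite Nf0 mulr0 => pf0; exists (((M + 1) / p f)%:C%C *: f).
    split; first exact: subspaceZ.
      by rewrite ipnormZ// -/(N f) Nf0 mulr0.
    rewrite p_homog// ger0_norm ?divr_ge0 ?addr_ge0// 1?ltW//.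
    by rewrite divfK ?ltrDl// gt_eqF.
  have Nf_gt0 : 0 < N f by rewrite lt_neqAle eq_sym Nf0 ipnorm_ge0.
  have t0 : 0 < r / 2 / N f by rewrite !divr_gt0.
  move=> pf; exists ((r / 2 / N f)%:C%C *: f); split; first exact: subspaceZ.
    rewrite ipnormZ// normc_real gtr0_norm// -/(N f) divfK//.
    by rewrite ltr_pdivrMr// ltr_pMr// ltr1n.
  rewrite p_homog// gtr0_norm//.
  apply: le_lt_trans (_ : r / 2 / N f * (M / (r / 2) * N f) < _).
    by rewrite le_eqVlt; apply/orP; left; apply/eqP; field; rewrite Nf0 gt_eqF.
  by rewrite ltr_pM2l.
have [lt_p|le_p] := ltP M (p (x + g)).
  exists (x + g); split; first exact: subspaceD.
    by rewrite addrC addKr.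
  by apply: le_lt_trans lt_p; rewrite le_max lexx.
exists (x - g); split; first exact: subspaceB.
  by rewrite addrC addKr ipnormN.
apply: (@le_lt_trans _ _ M); first by rewrite le_max lexx.
have H1 : H (x + g) by exact: subspaceD.
have H2 : H (x - g) by exact: subspaceB.
have := p_subadd H1 (subspaceZ ((-1)%:C)%C H2).
rewrite (_ : x + g + _ = (2%:R%:C)%C *: g); last first.
  rewrite (_ : ((-1)%:C)%C = -1 :> R[i]); last by rewrite rmorphN1.
  by rewrite scaleN1r opprB [x + g]addrC addrACA subrr addr0 rmorph_nat scaler_nat.
rewrite !p_homog// normrN1 mul1r ger0_norm//.
lra.
Qed.

(** Lower semicontinuity is given along sequences: were no radius to work, points within
    [1 / (n + 1)] of [y] with [p <= M] would converge to [y]. *)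
Lemma seminorm_gt_open (M : R) y : H y -> M < p y ->
  exists2 r : R, 0 < r & forall z, H z -> N (z - y) <= r -> M < p z.
Proof.
move=> Hy lt_py; apply: contrapT => noball.
have [|u uP] := choice (_ : forall n : nat, exists z,
    [/\ H z, N (z - y) <= n.+1%:R^-1 & p z <= M]).
  move=> n; apply: contrapT => nz; apply: noball.
  exists n.+1%:R^-1; first by rewrite invr_gt0.
  move=> z Hz Nz; rewrite ltNge; apply/negP => pz.
  by apply: nz; exists z.
move: lt_py; rewrite ltNge => /negP; apply.
apply: (p_lsc Hy (u := u)) => [n|| n]; [by have [] := uP n| |by have [] := uP n].
apply/cvgrPdist_le => eps eps0.
have [n nlt] := ltr_add_invr eps0; rewrite add0r in nlt.
exists n => // m nm /=; rewrite sub0r normrN ger0_norm ?ipnorm_ge0//.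
have [_ Num _] := uP m; apply: le_trans Num (le_trans _ (ltW nlt)).
by rewrite lef_pV2 ?posrE// ler_nat.
Qed.

(* Baire's argument: otherwise the open sets [{f | n < p f}] would all be dense. *)
Lemma lsc_seminorm_bounded : ip_complete H ip ->
  exists C : R, forall f, H f -> p f <= C * N f.
Proof.
move=> complH; apply: contrapT => nC.
have unb (C : R) : exists2 f, H f & C * N f < p f.
  apply: contrapT => nf; apply: nC; exists C => f Hf.
  by rewrite leNgt; apply/negP => lt_pf; apply: nf; exists f.
(* One step of the construction: inside the ball of centre [x] and radius [r], a closed ball on
   which [p] exceeds [n], with radius small enough to make the centres Cauchy. The step function is
   total, so it returns its input when [x] is not in [H] or [r <= 0]. *)
have [|step stepP] := choice (_ : forall a : nat * (V * R), exists b : V * R,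
    H a.2.1 -> 0 < a.2.2 -> [/\ H b.1, 0 < b.2 <= a.1.+1%:R^-1,
      N (b.1 - a.2.1) + b.2 <= a.2.2 &
      forall z, H z -> N (z - b.1) <= b.2 -> a.1%:R < p z]).
  case=> n [x r] /=; have [Hx|] := pselect (H x); last by exists (x, r).
  have [r0|] := ltP 0 r; last by exists (x, r).
  have r20 : 0 < r / 2 by rewrite divr_gt0.
  have [y [Hy Ny py]] := unbounded_seminorm_ball unb n%:R r20 Hx.
  have [r' r'0 r'P] := seminorm_gt_open Hy py.
  exists (y, Num.min r' (Num.min (r / 2) n.+1%:R^-1)) => _ _ /=; split => //.
  - by rewrite !lt_min r'0 r20 invr_gt0 ltr0n !ge_min lexx !orbT.
  - by rewrite [leRHS]splitr lerD ?(ltW Ny)// !ge_min lexx orbT.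
  - by move=> z Hz; rewrite le_min => /andP[Nz _]; exact: r'P.
pose b := fix b n := if n is m.+1 then step (m, b m) else (0, 1) : V * R.
have bP n : H (b n).1 /\ 0 < (b n).2.
  elim: n => [|n [Hn rn]]; first by split; [exact: subspace0|exact: ltr01].
  by have [? /andP[? _] _ _] := stepP (n, b n) Hn rn.
have bS n := let: conj Hn rn := bP n in stepP (n, b n) Hn rn.
have b_nested n m : N ((b (n + m)%N).1 - (b n).1) + (b (n + m)%N).2 <= (b n).2.
  elim: m => [|m]; first by rewrite addn0 subrr ipnorm0 add0r.
  apply: le_trans; rewrite addnS; have [_ _ le_b _] := bS (n + m)%N.
  have := ipnorm_dist (bP (n + m).+1).1 (bP (n + m)%N).1 (bP n).1.
  by rewrite /= in le_b *; rewrite -/N in le_b *; lra.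
(* Ball [m + 1] is built at step [m], and ball 0 is the arbitrary start; hence the strict
   inequality. *)
have r_small n m : (n < m)%N -> (b m).2 <= n.+1%:R^-1.
  case: m => // m; rewrite ltnS => nm; have [_ /andP[_ +] _ _] := bS m.
  by move=> /le_trans; apply; rewrite lef_pV2 ?posrE// ler_nat ltnS.
have N_small n m : N ((b (n + m)%N).1 - (b n).1) <= (b n).2.
  by apply: le_trans (b_nested n m); rewrite lerDl ltW//; case: (bP (n + m)%N).
have [eps eps0|f Hf] := complH (fun n => (b n).1) (fun n => (bP n).1).
  have eps20 : 0 < eps / 2 by rewrite divr_gt0.
  have [n nlt] := ltr_add_invr eps20; rewrite add0r in nlt.
  exists n.+1 => i j ni nj; rewrite (splitr eps).
  apply: le_lt_trans (ipnorm_dist (bP _).1 (bP n.+1).1 (bP _).1) _.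
  rewrite [X in _ + X]ipnormBC//; [|exact: (bP _).1..].
  rewrite -(subnKC ni) -(subnKC nj) ltrD//.
    by apply: le_lt_trans (N_small _ _) (le_lt_trans (r_small _ _ _) nlt).
  by apply: le_lt_trans (N_small _ _) (le_lt_trans (r_small _ _ _) nlt).
move=> /cvgrPdist_lt/= fP.
(* The limit of the centres lies in every closed ball of the sequence. *)
have N_lim n : N (f - (b n).1) <= (b n).2.
  apply/ler_addgt0Pl => eps /fP[m _ /(_ _ (leq_addl n m))/ltW].
  rewrite sub0r normrN ger0_norm ?ipnorm_ge0// [X in X <= _ -> _]ipnormBC//;
    last exact: (bP _).1.
  move=> le_eps; apply: le_trans (ipnorm_dist Hf (bP (n + m)%N).1 (bP n).1) _.
  by rewrite lerD.
have p_gt n : n%:R < p f by have [_ _ _] := bS n; apply => //; exact: (N_lim n.+1).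
have := p_gt (Num.truncn `|p f|).+1; rewrite ltNge => /negP; apply.
by apply: le_trans (ler_norm _) _; rewrite ltW// truncnS_gt.
Qed.

End BoundedSeminorm.

End SemiInnerProduct.

(** * Transport of the Hilbert space structure and of a basis *)

Section IsometricImage.
Variables (R : realType) (V W : lmodType R[i]) (H : set V).
Variables (ip : V -> V -> R[i]) (ipW : W -> W -> R[i]) (T : V -> W).
Hypothesis sip : semi_inner_product H ip.
Hypothesis T_lin : forall (c : R[i]) f g, H f -> H g ->
  T (c *: f + g) = c *: T f + T g.
Hypothesis T_null : forall f, H f -> ipnorm ip f = 0 -> T f = 0.
Hypothesis T_iso : forall f g, H f -> H g -> ipW (T f) (T g) = ip f g.

Lemma isometric_image0 : T 0 = 0.
Proof. by apply: T_null; [exact: subspace0 sip|exact: ipnorm0 sip]. Qed.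

Lemma isometric_imageB f g : H f -> H g -> T (f - g) = T f - T g.
Proof. by move=> Hf Hg; rewrite addrC -scaleN1r T_lin// scaleN1r addrC. Qed.

Lemma isometric_image_sum (A : seq int) (c : int -> R[i]) (e : int -> V) :
  (forall k, H (e k)) ->
  T (\sum_(k <- A) c k *: e k) = \sum_(k <- A) c k *: T (e k).
Proof.
move=> He; elim: A => [|k A IH]; first by rewrite !big_nil isometric_image0.
rewrite !big_cons T_lin// ?IH//; apply: (subspace_sum sip) => j _.
exact: (subspaceZ sip).
Qed.

Lemma ipnorm_isometric_image f : H f -> ipnorm ipW (T f) = ipnorm ip f.
Proof. by move=> Hf; rewrite /ipnorm T_iso. Qed.

(** The source form may have null vectors, the image form has none: by [T_null], [T f != 0] forces
    [ipnorm ip f != 0]. Cauchy sequences are lifted to preimages, where completeness is known. *)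
Lemma hilbert_isometric_image : ip_complete H ip ->
  hilbert_space (T @` H) ipW.
Proof.
move=> complH; split.
- split; first by exists 0; [exact: subspace0 sip|exact: isometric_image0].
  move=> c _ _ [f Hf <-] [g Hg <-]; exists (c *: f + g); last exact: T_lin.
  exact: (subspaceZD sip).
- split.
  + move=> c _ _ _ [f Hf <-] [g Hg <-] [k Hk <-].
    rewrite -T_lin// !T_iso//; first exact: (ip_lin sip).
    exact: (subspaceZD sip).
  + by move=> _ _ [f Hf <-] [g Hg <-]; rewrite !T_iso//; exact: (ip_conj sip).
  + move=> _ [f Hf <-] Tf0; rewrite T_iso// (ipE sip Hf) ltcR exprn_gt0//.
    rewrite lt_neqAle (ipnorm_ge0 ip f) andbT eq_sym.
    by apply: contra Tf0 => /eqP/(T_null Hf)->.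
- move=> u Hu cauchy.
  have [|F FP] := choice (_ : forall n, exists f, H f /\ T f = u n).
    by move=> n; have [f] := Hu n; exists f.
  have HF n : H (F n) by case: (FP n).
  have uE n : u n = T (F n) by case: (FP n).
  have [eps eps0|f Hf Ff] := complH F HF.
    have [n nP] := cauchy _ eps0; exists n => k l nk nl.
    rewrite -ipnorm_isometric_image ?isometric_imageB -?uE ?nP//.
    exact: (subspaceB sip).
  exists (T f); first by exists f.
  rewrite (_ : (fun n => _) = fun n => ipnorm ip (F n - f))//; apply/funext => n.
  rewrite uE -isometric_imageB// ipnorm_isometric_image//.
  exact: (subspaceB sip).
Qed.

Lemma onb_isometric_image e : orthonormal_basis H ip e ->
  orthonormal_basis (T @` H) ipW (T \o e).
Proof.
case=> He e_orth e_dense; split => [k|k l|_ [f Hf <-] eps eps0].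
- by exists (e k).
- by rewrite /= T_iso.
have [A [c lt_eps]] := e_dense _ Hf _ eps0; exists A, c.
have Hs : H (\sum_(k <- A) c k *: e k).
  by apply: (subspace_sum sip) => k _; exact: (subspaceZ sip).
rewrite -isometric_image_sum// -isometric_imageB// ipnorm_isometric_image//.
exact: (subspaceB sip).
Qed.

End IsometricImage.

(** * The space of square-integrable functions *)

#[local] Instance lebesgue_ae_filter (R : realType) :
  Filter (almost_everywhere (@lebesgue_measure R)).
Proof. exact: ae_filter_ringOfSetsType. Qed.

(** * Measurability and integration of complex-valued functions *)

Section ComplexMeasurable.
Variables (R : realType) (D : set R).
Local Notation mu := (@lebesgue_measure R).
Implicit Types f g : R -> R[i].

(* [lebesgue_measure] lives on [measurableTypeR R]; without the casts below, the
   measurable structure inferred on [R] has another display. *)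
Definition cmeasurable f : Prop :=
  measurable_fun (D : set (measurableTypeR R)) (fun x => complex.Re (f x)) /\
  measurable_fun (D : set (measurableTypeR R)) (fun x => complex.Im (f x)).

Lemma cmeasurable_cst c : cmeasurable (fun=> c).
Proof. by split; exact: measurable_cst. Qed.

Lemma cmeasurableD f g :
  cmeasurable f -> cmeasurable g -> cmeasurable (fun x => f x + g x).
Proof.
move=> [rf imf] [rg img]; split.
  by under eq_fun do rewrite ReD; exact: measurable_funD.
by under eq_fun do rewrite ImD; exact: measurable_funD.
Qed.

Lemma cmeasurableM f g :
  cmeasurable f -> cmeasurable g -> cmeasurable (fun x => f x * g x).
Proof.
move=> [rf imf] [rg img]; split.
  by under eq_fun do rewrite ReM; apply: measurable_funB; exact: measurable_funM.
by under eq_fun do rewrite ImM; apply: measurable_funD; exact: measurable_funM.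
Qed.

Lemma cmeasurable_conjc f : cmeasurable f -> cmeasurable (fun x => conjc (f x)).
Proof.
move=> [rf imf]; split; first by under eq_fun do rewrite Re_conjc.
by under eq_fun do rewrite Im_conjc; exact: measurableT_comp.
Qed.

Lemma cmeasurableB f g :
  cmeasurable f -> cmeasurable g -> cmeasurable (fun x => f x - g x).
Proof.
move=> mf mg; under eq_fun do rewrite -mulN1r.
by apply: cmeasurableD => //; apply: cmeasurableM => //; exact: cmeasurable_cst.
Qed.

Lemma measurable_sqr_normc f :
  cmeasurable f ->
  measurable_fun (D : set (measurableTypeR R)) (fun x => normc (f x) ^+ 2).
Proof.
move=> [rf imf]; under eq_fun do rewrite sqr_normcE.
by apply: measurable_funD; exact: measurable_funX.
Qed.

Lemma cintegrable_measurable f : cintegrable D f -> cmeasurable f.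
Proof.
by move=> [/measurable_int/measurable_EFinP ? /measurable_int/measurable_EFinP].
Qed.

Hypothesis mD : measurable (D : set (measurableTypeR R)).

Lemma cintegrable_le f (u : R -> R) : cmeasurable f ->
  mu.-integrable D (EFin \o u) -> (forall x, D x -> normc (f x) <= u x) ->
  cintegrable D f.
Proof.
move=> [rf imf] int_u le_u; split; apply: (le_integrable mD _ _ int_u).
- exact/measurable_EFinP.
- move=> x Dx; rewrite lee_fin.
  exact: le_trans (Re_le_normc _) (le_trans (le_u _ Dx) (ler_norm _)).
- exact/measurable_EFinP.
- move=> x Dx; rewrite lee_fin.
  exact: le_trans (Im_le_normc _) (le_trans (le_u _ Dx) (ler_norm _)).
Qed.

Lemma cintegralD f g : cintegrable D f -> cintegrable D g ->
  cintegral D (fun x => f x + g x) = cintegral D f + cintegral D g.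
Proof.
move=> [rf imf] [rg img]; apply: complex_eqP; rewrite ?ReD ?ImD /=.
  by under eq_Rintegral do rewrite ReD; rewrite RintegralD.
by under eq_Rintegral do rewrite ImD; rewrite RintegralD.
Qed.

Let integrable_mulr (r : R) (u : R -> R) : mu.-integrable D (EFin \o u) ->
  mu.-integrable D (EFin \o (fun x => r * u x)).
Proof. by move=> /(integrableZl mD r). Qed.

Lemma cintegrableD f g : cintegrable D f -> cintegrable D g ->
  cintegrable D (fun x => f x + g x).
Proof.
move=> [rf imf] [rg img]; split.
  by under eq_fun do rewrite ReD; exact: (integrableD mD rf rg).
by under eq_fun do rewrite ImD; exact: (integrableD mD imf img).
Qed.

Lemma cintegrableZl c f : cintegrable D f -> cintegrable D (fun x => c * f x).
Proof.
move=> [rf imf]; split.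
  under eq_fun do rewrite ReM.
  exact: (integrableB mD (integrable_mulr _ rf) (integrable_mulr _ imf)).
under eq_fun do rewrite ImM.
exact: (integrableD mD (integrable_mulr _ imf) (integrable_mulr _ rf)).
Qed.

Lemma cintegralZl c f : cintegrable D f ->
  cintegral D (fun x => c * f x) = c * cintegral D f.
Proof.
move=> [rf imf].
apply: complex_eqP; rewrite ?ReM ?ImM /=.
  under eq_Rintegral do rewrite ReM.
  by rewrite RintegralB// ?RintegralZl//; exact: integrable_mulr.
under eq_Rintegral do rewrite ImM.
by rewrite RintegralD// ?RintegralZl//; exact: integrable_mulr.
Qed.

Lemma cintegral_conjc f : cintegrable D f ->
  cintegral D (fun x => conjc (f x)) = conjc (cintegral D f).
Proof.
move=> [rf imf]; apply: complex_eqP; rewrite ?Re_conjc ?Im_conjc /=.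
  by under eq_Rintegral do rewrite Re_conjc.
under eq_Rintegral do rewrite Im_conjc -mulN1r.
by rewrite RintegralZl// mulN1r.
Qed.

Lemma eq_cintegral f g : (forall x, D x -> f x = g x) ->
  cintegral D f = cintegral D g.
Proof.
by move=> fg; apply: complex_eqP; apply: eq_Rintegral => x /set_mem/fg ->.
Qed.

Lemma ae_eq_cintegral f g : cmeasurable f -> cmeasurable g ->
  f = g %[ae mu in D] -> cintegral D f = cintegral D g.
Proof.
move=> [rf imf] [rg img] fg; apply: complex_eqP; congr fine; apply: ae_eq_integral => //.
- exact/measurable_EFinP.
- exact/measurable_EFinP.
- by apply: filterS fg => x + Dx => /(_ Dx) ->.
- exact/measurable_EFinP.
- exact/measurable_EFinP.
- by apply: filterS fg => x + Dx => /(_ Dx) ->.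
Qed.

End ComplexMeasurable.

(** * [L^2] as a semi-inner product space *)

Section L2.
Variables (R : realType) (D : set R).
Local Notation mu := (@lebesgue_measure R).
Hypothesis mD : measurable (D : set (measurableTypeR R)).
Implicit Types f g : R -> R[i].

Lemma L2P f : L2 D f <->
  cmeasurable D f /\ mu.-integrable D (EFin \o (fun x => normc (f x) ^+ 2)).
Proof.
have absE x : `|(EFin \o (fun x => normc (f x) ^+ 2)%R) x|%E = (normc (f x) ^+ 2)%:E.
  by rewrite /= ger0_norm// sqr_ge0.
split=> [[rf imf lty]|[[rf imf] /integrableP[_ lty]]].
  have mf : cmeasurable D f by split.
  split => //; apply/integrableP; split.
    by apply/measurable_EFinP; exact: measurable_sqr_normc.
  by under eq_integral do rewrite absE.
by split => //; under eq_integral do rewrite -absE.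
Qed.

Lemma L2_measurable f : L2 D f -> cmeasurable D f.
Proof. by case/L2P. Qed.

(** The product is dominated by [|f|^2 + |g|^2]. *)
Lemma L2_integrable_mul f g : L2 D f -> L2 D g -> cintegrable D (fun x => f x * g x).
Proof.
move=> /L2P[mf f2] /L2P[mg g2].
apply: (cintegrable_le mD (cmeasurableM mf mg) (integrableD mD f2 g2)) => x _ /=.
rewrite normcM; have := normc_ge0 (f x); have := normc_ge0 (g x).
move: (normc _) (normc _) => a b a0 b0; nra.
Qed.

Lemma L2_conjc f : L2 D f -> L2 D (fun x => conjc (f x)).
Proof.
move=> /L2P[mf f2]; apply/L2P; split; first exact: cmeasurable_conjc.
by under eq_fun do rewrite normc_conjc.
Qed.

Lemma L2_linear c f g : L2 D f -> L2 D g -> L2 D (c *: f + g).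
Proof.
move=> /L2P[mf f2] /L2P[mg g2]; apply/L2P.
have mcfg : cmeasurable D (c *: f + g).
  by apply: cmeasurableD => //; apply: cmeasurableM => //; exact: cmeasurable_cst.
split => //.
(* From [|c f + g|^2 <= 2 (|c f|^2 + |g|^2)]. *)
pose u x : R := 2 * (normc c ^+ 2 * normc (f x) ^+ 2 + normc (g x) ^+ 2).
have int_u : mu.-integrable D (EFin \o u).
  have int_cf := integrableZl mD (normc c ^+ 2) f2.
  exact: (integrableZl mD 2 (integrableD mD int_cf g2)).
apply: (le_integrable mD _ _ int_u).
  by apply/measurable_EFinP; exact: measurable_sqr_normc.
move=> x _ /=; rewrite lee_fin !ger0_norm ?sqr_ge0//; last first.
  by rewrite /u -exprMn mulr_ge0// addr_ge0// sqr_ge0.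
rewrite /u -exprMn -normcM.
have := ler_normcD (c * f x) (g x); have := normc_ge0 (c * f x + g x).
have := normc_ge0 (c * f x); have := normc_ge0 (g x).
rewrite (_ : (c *: f + g) x = c * f x + g x)//.
move: (normc (c * f x + g x)) (normc (c * f x)) (normc (g x)) => d a b b0 a0 d0 dle.
apply: (@le_trans _ _ ((a + b) ^+ 2)); first by rewrite lerXn2r// nnegrE addr_ge0.
by have := sqr_ge0 (a - b); rewrite sqrrB sqrrD; lra.
Qed.

Lemma ipL2_diag f :
  ipL2 D f f = ((\int[mu]_(x in D) normc (f x) ^+ 2)%:C)%C.
Proof.
apply: complex_eqP => /=; first by under eq_Rintegral do rewrite mul_conjcE.
under eq_Rintegral do rewrite mul_conjcE.
by rewrite /Rintegral integral0.
Qed.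

Lemma L2_semi_inner_product : semi_inner_product (L2 D) (@ipL2 R D).
Proof.
split.
- split; last exact: L2_linear.
  apply/L2P; split; first exact: cmeasurable_cst.
  rewrite (_ : _ \o _ = cst 0%E); first exact: integrable0.
  by apply/funext => x /=; rewrite expr0n addr0 sqrtr0 expr0n.
- move=> c f g k Lf Lg Lk; have Lk' := L2_conjc Lk.
  have [fk gk] := (L2_integrable_mul Lf Lk', L2_integrable_mul Lg Lk').
  rewrite /ipL2 -cintegralZl// -cintegralD//; last exact: cintegrableZl.
  by apply: eq_cintegral => x _; rewrite mulrA -mulrDl.
- move=> f g Lf Lg; rewrite /ipL2 -cintegral_conjc//.
    by apply: eq_cintegral => x _; rewrite rmorphM/= conjcK mulrC.
  exact: L2_integrable_mul Lf (L2_conjc Lg).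
- by move=> f _; rewrite ipL2_diag ler0c Rintegral_ge0// => x _; exact: sqr_ge0.
Qed.

Lemma sqr_ipnormL2 f : L2 D f ->
  ((ipnorm (@ipL2 R D) f ^+ 2)%:E = \int[mu]_(x in D) (normc (f x) ^+ 2)%:E)%E.
Proof.
move=> Lf; rewrite (sqr_ipnorm L2_semi_inner_product Lf) ipL2_diag/=.
by rewrite fineK//; case/L2P: Lf => _ /(integrable_fin_num mD).
Qed.

Lemma ipnormL2_eq0 f : L2 D f ->
  ipnorm (@ipL2 R D) f = 0 <-> f = cst 0 %[ae mu in D].
Proof.
move=> Lf; have mf := measurable_sqr_normc (L2_measurable Lf).
transitivity (\int[mu]_(x in D) `|(normc (f x) ^+ 2)%:E| = 0)%E.
  under eq_integral do rewrite gee0_abs ?lee_fin ?sqr_ge0//.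
  rewrite -sqr_ipnormL2//; split=> [->|/eqP]; first by rewrite expr0n.
  by rewrite eqe sqrf_eq0 => /eqP.
transitivity (ae_eq mu D (fun x => (normc (f x) ^+ 2)%:E) (cst 0%E)).
  by apply: ae_eq_integral_abs => //; exact/measurable_EFinP.
split; apply: filterS => x + Dx => /(_ Dx).
  by move=> /eqP; rewrite eqe sqrf_eq0 => /eqP/normc_eq0.
by move=> -> /=; rewrite expr0n/= addr0 sqrtr0 expr0n.
Qed.

End L2.

(** Fatou in the form that serves both completeness of [L^2] and lower semicontinuity: a bound on
    all the integrals passes to an a.e. limit. Deleting the exceptional null set makes [g] a
    pointwise lower limit. *)
Lemma ge0_fatou_bound d (T : measurableType d) (R : realType)
    (mu : {measure set T -> \bar R}) (D : set T) (u : nat -> T -> R) (g : T -> R)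
    (M : R) :
  measurable D -> (forall n, measurable_fun D (u n)) -> measurable_fun D g ->
  (forall n x, 0 <= u n x) -> (forall x, 0 <= g x) ->
  {ae mu, forall x, D x -> u ^~ x @ \oo --> g x} ->
  (forall n, \int[mu]_(x in D) (u n x)%:E <= M%:E)%E ->
  (\int[mu]_(x in D) (g x)%:E <= M%:E)%E.
Proof.
move=> mD mu_ mg u0 g0 [N [mN N0 cvgN]] le_M.
have DN : D `\` N `<=` D by exact: subDsetl.
have mDN : measurable (D `\` N) by exact: measurableD.
rewrite (ge0_negligible_integral mN)//; [|exact/measurable_EFinP|];
  last by move=> x _; rewrite lee_fin.
rewrite (eq_integral (fun x => limn_einf (fun n => (u n x)%:E))); last first.
  move=> x /set_mem[Dx Nx].
  have ux : u ^~ x @ \oo --> g x.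
    by apply: contrapT => nux; apply/Nx/cvgN => /(_ Dx).
  have eux : (fun n => (u n x)%:E) @ \oo --> (g x)%:E.
    by apply: cvg_EFin => //; exact: nearW.
  by have [->] := cvg_limn_einf_sup eux.
apply: (@le_trans _ _ (limn_einf (fun n => \int[mu]_(x in D `\` N) (u n x)%:E)%E)).
  apply: fatou => // [n|n x _]; last by rewrite lee_fin.
  by apply/measurable_EFinP; exact: measurable_funS mD DN (mu_ n).
rewrite limn_einf_lim; apply: lime_le; first exact: is_cvg_einfs.
apply: nearW => n; apply: le_trans (ereal_inf_lbound _) _.
  by exists n => /=.
apply: le_trans (le_M n).
apply: ge0_subset_integral => //; first by apply/measurable_EFinP.
by move=> x _; rewrite lee_fin.
Qed.

(** The telescoping series is dominated by a geometric one. *)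
Lemma cvg_geometric_dist (R : realType) (r : nat -> R) (C : R) :
  (forall k, `|r k.+1 - r k| <= C * 2 ^- k) -> cvgn r.
Proof.
move=> le_r.
have -> : r = fun n => r 0%N + series (telescope r) n.
  by apply/funext => n; exact: eq_sum_telescope.
apply: is_cvgD; first exact: is_cvg_cst.
apply: normed_cvg; apply: (series_le_cvg (v_ := geometric C 2^-1)) => //=.
- by move=> n; rewrite exprVn; exact: le_trans (normr_ge0 _) (le_r n).
- by move=> n; rewrite exprVn; exact: le_r.
- by apply: is_cvg_geometric_series; rewrite ger0_norm ?invr_ge0// invf_lt1// ltr1n.
Qed.

(** * Completeness of [L^2] *)

Section L2Complete.
Variables (R : realType) (D : set R).
Local Notation mu := (@lebesgue_measure R).
Hypothesis mD : measurable (D : set (measurableTypeR R)).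
Local Notation N := (ipnorm (@ipL2 R D)).

(** Membership of the limit in [L^2] is part of the conclusion; this is how the limit of a Cauchy
    sequence is placed in the space. *)
Lemma L2_fatou (u : nat -> R -> R[i]) f (M : R) : 0 <= M ->
  (forall n, L2 D (u n)) -> cmeasurable D f ->
  {ae mu, forall x, D x -> (fun n => complex.Re (u n x)) @ \oo --> complex.Re (f x) /\
                           (fun n => complex.Im (u n x)) @ \oo --> complex.Im (f x)} ->
  (forall n, N (u n) <= M) -> L2 D f /\ N f <= M.
Proof.
move=> M0 Lu mf uf le_M.
have le_M2 : (\int[mu]_(x in D) (normc (f x) ^+ 2)%:E <= (M ^+ 2)%:E)%E.
  apply: (@ge0_fatou_bound _ (measurableTypeR R) R _ _
    (fun n x => normc (u n x) ^+ 2)) => //.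
  - by move=> n; apply: measurable_sqr_normc; exact: L2_measurable.
  - exact: measurable_sqr_normc.
  - by move=> n x; exact: sqr_ge0.
  - by move=> x; exact: sqr_ge0.
  - apply: filterS uf => x + Dx => /(_ Dx)[cvg_re cvg_im].
    under eq_fun do rewrite sqr_normcE.
    rewrite sqr_normcE.
    by apply: cvgD; rewrite expr2; under eq_fun do rewrite expr2; exact: cvgM.
  - by move=> n; rewrite -sqr_ipnormL2// lee_fin lerXn2r// nnegrE ipnorm_ge0.
have Lf : L2 D f.
  by case: mf => rf imf; split => //; apply: le_lt_trans le_M2 (ltry _).
split => //; rewrite -(@ler_pXn2r _ 2)// ?nnegrE ?ipnorm_ge0//.
by rewrite -lee_fin sqr_ipnormL2.
Qed.


(* Along a subsequence [v] with [N (v k - v k.+1) < 4 ^- k], the series of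
   [4 ^+ k * |v k - v k.+1| ^+ 2] is integrable, and wherever it is finite,
   [|v k - v k.+1| = O(2 ^- k)]. *)
Lemma L2_complete : ip_complete (L2 D) (@ipL2 R D).
Proof.
have sip := L2_semi_inner_product mD.
move=> u Lu cauchy.
have [|K KP] := choice (_ : forall k : nat, exists K : nat, forall m n,
    (K <= m)%N -> (K <= n)%N -> N (u m - u n) < 4 ^- k).
  by move=> k; apply: cauchy; rewrite invr_gt0 exprn_gt0.
(* Running sums of [K] are nondecreasing and dominate [K], so they can index [v]. *)
pose s k := (\sum_(i < k.+1) K i)%N.
have Ks k : (K k <= s k)%N by rewrite /s big_ord_recr leq_addl.
have s_mono m n : (m <= n)%N -> (s m <= s n)%N.
  move=> /subnKC <-; elim: (n - m)%N => [|j IH]; first by rewrite addn0.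
  by apply: leq_trans IH _; rewrite /s addnS [leqRHS]big_ord_recr leq_addr.
pose v k := u (s k); have Lv k : L2 D (v k) by exact: Lu.
have LvB m n : L2 D (v m - v n) by exact: (subspaceB sip).
have Nv m n : (m <= n)%N -> N (v m - v n) < 4 ^- m.
  by move=> mn; apply: KP => //; apply: leq_trans (s_mono _ _ mn).
pose G k x : R := 4 ^+ k * normc ((v k - v k.+1) x) ^+ 2.
have G0 k x : 0 <= G k x by apply: mulr_ge0; [exact: exprn_ge0|exact: sqr_ge0].
have mG k : measurable_fun (D : set (measurableTypeR R)) (G k).
  apply: measurable_funM => //; apply: measurable_sqr_normc.
  exact: L2_measurable.
have intG k : (\int[mu]_(x in D) (G k x)%:E <= (4 ^- k)%:E)%E.
  under eq_integral do rewrite EFinM.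
  rewrite ge0_integralZl_EFin//; last 2 first.
  - by move=> x _; rewrite lee_fin sqr_ge0.
  - apply/measurable_EFinP; apply: measurable_sqr_normc; exact: L2_measurable.
  rewrite -sqr_ipnormL2// -EFinM lee_fin.
  apply: (@le_trans _ _ (4 ^+ k * (4 ^- k) ^+ 2)).
    rewrite ler_pM2l ?exprn_gt0// lerXn2r ?nnegrE ?ipnorm_ge0//.
    exact/ltW/Nv.
  by rewrite expr2 mulVKf// expf_eq0 pnatr_eq0 andbF.
have sum_fin : (\sum_(0 <= k <oo) (4 ^- k : R)%:E < +oo)%E.
  apply: (@le_lt_trans _ _ 2%:E); last exact: ltry.
  apply: lime_le.
    by apply: is_cvg_nneseries => k _ _; rewrite lee_fin invr_ge0 exprn_ge0.
  apply: nearW => n; rewrite sumEFin lee_fin.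
  (* Strengthened for the induction: the crude bound 2 leaves the slack [2 * 4 ^- n], which absorbs
     the next term. *)
  suff : \sum_(0 <= k < n) 4 ^- k + 2 * 4 ^- n <= 2 :> R.
    by apply: le_trans; rewrite lerDl mulr_ge0// invr_ge0 exprn_ge0.
  elim: n => [|n IH]; first by rewrite big_geq// add0r expr0 invr1 mulr1.
  rewrite big_nat_recr//= exprSr invfM.
  have : 0 <= 4 ^- n :> R by rewrite invr_ge0 exprn_ge0.
  lra.
have G_fin : {ae mu, forall x, D x -> (\sum_(0 <= k <oo) (G k x)%:E)%E \is a fin_num}.
  apply: (integrable_ae mD); apply/integrableP; split.
    apply: ge0_emeasurable_sum => // [k x Dx _|k _]; first by rewrite lee_fin.
    exact/measurable_EFinP.
  have G_ge0 x : (0 <= \sum_(0 <= k <oo) (G k x)%:E)%E.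
    by apply: nneseries_ge0 => k _ _; rewrite lee_fin.
  under eq_integral => x _ do rewrite (gee0_abs (G_ge0 x)).
  rewrite integral_nneseries//; last 2 first.
  - by move=> k; exact/measurable_EFinP.
  - by move=> k x _; rewrite lee_fin.
  apply: le_lt_trans (lee_nneseries _ _) sum_fin => [k _ _|k _]; last exact: intG.
  by apply: integral_ge0 => x _; rewrite lee_fin.
have v_cvg x : D x -> (\sum_(0 <= k <oo) (G k x)%:E)%E \is a fin_num ->
    cvgn (fun n => complex.Re (v n x)) /\ cvgn (fun n => complex.Im (v n x)).
  move=> Dx /fineK; set g := fine _ => gE.
  have Gg k : G k x <= g.
    rewrite -lee_fin gE; apply: le_trans (nneseries_lim_ge k.+1 _) => //=.
      rewrite big_nat_recr//= leeDr// sume_ge0// => i _; by rewrite lee_fin.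
    by move=> i _ _; rewrite lee_fin.
  have g0 : 0 <= g by exact: le_trans (G0 0%N x) (Gg 0%N).
  (* After squaring, this is [4 ^+ k * |.|^2 <= g <= (1 + g) ^+ 2]; the constant [1 + g] avoids a
     square root. *)
  have dist_v k : normc ((v k - v k.+1) x) <= (1 + g) / 2 ^+ k.
    rewrite ler_pdivlMr ?exprn_gt0// -(@ler_pXn2r _ 2)//; last 2 first.
    - by rewrite nnegrE mulr_ge0 ?normc_ge0 ?exprn_ge0.
    - by rewrite nnegrE addr_ge0.
    rewrite exprMn -exprM mulnC exprM mulrC.
    apply: (@le_trans _ _ g); first by rewrite -natrX; exact: Gg.
    nra.
  split; apply: (@cvg_geometric_dist _ _ (1 + g)) => k; apply: le_trans (dist_v k);
    rewrite distrC; [rewrite -ReN -ReD|rewrite -ImN -ImD].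
    exact: Re_le_normc.
  exact: Im_le_normc.
(* An upper limit is measurable whether or not the sequence converges, and is the limit wherever it
   does; [fine] sends infinite values to 0. *)
pose f x := Complex (fine (limn_esup (fun n => (complex.Re (v n x))%:E)))
                    (fine (limn_esup (fun n => (complex.Im (v n x))%:E))).
have mf : cmeasurable D f.
  split; apply: (measurableT_comp (fine_measurable measurableT));
    apply: measurable_fun_limn_esup => n; apply/measurable_EFinP;
    by have [] := L2_measurable (Lv n).
have fine_lim (r : nat -> R) : cvgn r ->
    r @ \oo --> fine (limn_esup (fun n => (r n)%:E)).
  move=> /cvg_ex[l rl]; have er : (fun n => (r n)%:E) @ \oo --> l%:E.
    by apply: cvg_EFin => //; exact: nearW.
  by have [_ ->] := cvg_limn_einf_sup er.
have vf : {ae mu, forall x, D x ->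
    (fun n => complex.Re (v n x)) @ \oo --> complex.Re (f x) /\
    (fun n => complex.Im (v n x)) @ \oo --> complex.Im (f x)}.
  apply: filterS G_fin => x + Dx => /(_ Dx)/(v_cvg _ Dx)[cvg_re cvg_im].
  by split; exact: fine_lim.
have v_lim k : L2 D (v k - f) /\ N (v k - f) <= 4 ^- k.
  (* Fatou in [n] with [k] fixed turns the Cauchy bound into a bound on the distance to the
     limit. *)
  apply: (L2_fatou (u := fun n => v k - v (n + k)%N)) => //.
  - apply: cmeasurableB => //; exact: L2_measurable.
  - apply: filterS vf => x + Dx => /(_ Dx)[cvg_re cvg_im].
    split; under eq_fun do rewrite ?(ReD, ReN) ?(ImD, ImN).
      rewrite ReD ReN; apply: cvgB; first exact: cvg_cst.
      by have := cvg_re; rewrite -(cvg_shiftn k).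
    rewrite ImD ImN; apply: cvgB; first exact: cvg_cst.
    by have := cvg_im; rewrite -(cvg_shiftn k).
  - by move=> n; apply/ltW/Nv/leq_addl.
have Lf : L2 D f.
  rewrite -[f](subKr (v 0%N)); apply: (subspaceB sip) => //.
  by case: (v_lim 0%N).
exists f => //; apply/cvgrPdist_lt => eps eps0.
have eps20 : 0 < eps / 2 by rewrite divr_gt0.
have [k] := ltr_add_invr eps20; rewrite add0r => ltk.
have ltk4 : 4 ^- k < eps / 2.
  apply: le_lt_trans ltk; rewrite lef_pV2 ?posrE ?exprn_gt0// -natrX ler_nat.
  by rewrite ltn_expl.
exists (K k) => // n Kn /=; rewrite sub0r normrN ger0_norm ?ipnorm_ge0//.
rewrite (splitr eps); apply: le_lt_trans (ipnorm_dist sip (Lu n) (Lv k) Lf) _.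
rewrite ltrD//; first by apply: lt_trans ltk4; apply: KP.
by apply: le_lt_trans ltk4; case: (v_lim k).
Qed.

End L2Complete.

(** * Functionals defined by integrals *)

Section AeEqIntegral.
Context d (T : measurableType d) (R : realType).
Variable mu : {measure set T -> \bar R}.
Implicit Types f g : T -> \bar R.

Import HBNNSimple.
Local Open Scope ereal_scope.

(** Monotonicity with no measurability: the integral of a nonnegative function is a supremum over
    the simple functions below it. *)
Let le_integralT f g : (forall x, 0 <= f x) -> (forall x, f x <= g x) ->
  \int[mu]_x f x <= \int[mu]_x g x.
Proof.
move=> f0 fg; have g0 x : 0 <= g x by exact: le_trans (f0 x) (fg x).
rewrite !ge0_integralTE//; apply: ereal_sup_le => _ [h hf <-].
by exists h => // x; exact: le_trans (hf x) (fg x).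
Qed.

(* Only [g] need be measurable: [f] is squeezed, everywhere, between [g]
   restricted to the complement of a null set and a modification of [g] that is
   infinite on that null set. *)
Lemma ge0_ae_eq_integralr f g : measurable_fun setT g ->
  (forall x, 0 <= f x) -> (forall x, 0 <= g x) -> f = g %[ae mu] ->
  \int[mu]_x f x = \int[mu]_x g x.
Proof.
move=> mg f0 g0 [N [mN N0 fgN]].
have fg x : ~ N x -> f x = g x.
  by move=> Nx; apply: contrapT => nfg; apply/Nx/fgN => /(_ I).
have ae_notN : {ae mu, forall x, ~ N x}.
  by exists N; split => // x /=; rewrite notK.
apply/eqP; rewrite eq_le; apply/andP; split.
- pose gy x := if x \in N then +oo else g x.
  have gy0 x : 0 <= gy x by rewrite /gy; case: ifP.
  have mgy : measurable_fun setT gy.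
    apply: measurable_fun_ifT => //; apply: (measurable_fun_bool true).
    rewrite setTI (_ : _ @^-1` _ = N)//.
    by apply/seteqP; split=> x /= => [/set_mem|/mem_set].
  apply: (@le_trans _ _ (\int[mu]_x gy x)).
    apply: le_integralT => // x; rewrite /gy; case: ifPn => [_|/negP xN].
      exact: leey.
    by rewrite fg// => Nx; apply: xN; rewrite inE.
  apply: ae_ge0_le_integral => //; apply: filterS ae_notN => x Nx _.
  by rewrite /gy memNset.
- rewrite (ge0_negligible_integral mN)// integral_mkcond.
  apply: le_integralT => x; first by apply: erestrict_ge0.
  by rewrite patchE; case: ifPn => // /set_mem[_ Nx]; rewrite fg.
Qed.

Lemma ae_eq_integralr f g : measurable_fun setT g -> f = g %[ae mu] ->
  \int[mu]_x f x = \int[mu]_x g x.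
Proof.
move=> mg /ae_eq_funeposneg[fgp fgn]; rewrite integralE [RHS]integralE.
congr (_ - _); apply: ge0_ae_eq_integralr => //.
- exact: measurable_funepos.
- exact: measurable_funeneg.
Qed.

End AeEqIntegral.

Lemma ae_foralln d (T : measurableType d) (R : realType)
    (mu : {measure set T -> \bar R}) (P : nat -> T -> Prop) :
  (forall n, {ae mu, forall x, P n x}) -> {ae mu, forall x, forall n, P n x}.
Proof.
move=> aeP; apply: negligibleS (negligible_bigcup aeP) => x /=.
by move=> /existsNP[n nP]; exists n.
Qed.

(** * Boundedness of integral functionals *)

Section IntegralFunctional.
Variables (R : realType) (V : lmodType R[i]) (H : set V) (ip : V -> V -> R[i]).
Hypothesis sip : semi_inner_product H ip.
Hypothesis complH : ip_complete H ip.
Context d (T : measurableType d) (mu : {measure set T -> \bar R}).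
Variable m : V -> T -> R.
Hypothesis mD : forall f g, H f -> H g -> forall x, m (f + g) x = m f x + m g x.
Hypothesis mZ : forall (c : R) f, H f -> forall x, m ((c%:C)%C *: f) x = c * m f x.
Hypothesis m_cvg : forall f (u : nat -> V), H f -> (forall n, H (u n)) ->
  (fun n => ipnorm ip (u n - f)) @ \oo --> (0 : R) ->
  forall x, (fun n => m (u n) x) @ \oo --> m f x.
Hypothesis m_int : forall f, H f -> exists2 g : T -> R,
  mu.-integrable setT (EFin \o g) & m f = g %[ae mu].

Let p f := \int[mu]_x `|m f x|.

(** [p] is a real integral, in which an infinite value would read as 0. Integrability of the
    representative rules this out, so inequalities on [p] can be proved in the extended reals. *)
Let pE f (g : T -> R) : mu.-integrable setT (EFin \o g) -> m f = g %[ae mu] ->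
  ((p f)%:E = \int[mu]_x (`|g x|)%:E)%E.
Proof.
move=> int_g mg; have int_ng := integrable_norm int_g.
rewrite /p /Rintegral (ae_eq_integralr (g := fun x => (`|g x|)%:E)).
- exact/fineK/integrable_fin_num.
- exact: measurable_int int_ng.
- by apply: filterS mg => x /(_ I) ->.
Qed.

(** [m_int] gives finiteness vector by vector; completeness makes it uniform. The argument runs on
    [p], which dominates the functional and has the nonnegative integrand that Fatou asks for. *)
Lemma integral_functional_bounded :
  exists C : R, forall f, H f -> `|\int[mu]_x m f x| <= C * ipnorm ip f.
Proof.
have [|||C CP] := @lsc_seminorm_bounded R V H ip sip p _ _ _ complH.
- move=> f g Hf Hg.
  have [[f' int_f ff'] [g' int_g gg']] := (m_int Hf, m_int Hg).
  have int_fg : mu.-integrable setT (EFin \o (fun x => f' x + g' x)).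
    exact: integrableD int_f int_g.
  rewrite -lee_fin (pE int_fg); last first.
    by apply: filterS2 ff' gg' => x fx gx _; rewrite mD// fx// gx.
  rewrite EFinD (pE int_f ff') (pE int_g gg').
  have nf := integrable_norm int_f; have ng := integrable_norm int_g.
  rewrite -integralD//; apply: ge0_le_integral => //.
  + exact: measurable_int (integrable_norm int_fg).
  + exact: measurable_int (integrableD measurableT nf ng).
  + by move=> x _; rewrite lee_fin ler_normD.
- move=> t f Hf; have [f' int_f ff'] := m_int Hf.
  have int_tf : mu.-integrable setT (EFin \o (fun x => t * f' x)).
    exact: integrableZl int_f.
  apply: EFin_inj; rewrite (pE int_tf); last first.
    by apply: filterS ff' => x fx _; rewrite mZ// fx.
  rewrite EFinM (pE int_f ff') -ge0_integralZl_EFin//.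
  + by apply: eq_integral => x _; rewrite normrM.
  + exact: measurable_int (integrable_norm int_f).
- move=> M f u Hf Hu uf le_M; have [f' int_f ff'] := m_int Hf.
  have [|u' u'P] := choice (_ : forall n, exists g : T -> R,
      mu.-integrable setT (EFin \o g) /\ m (u n) = g %[ae mu]).
    by move=> n; have [g] := m_int (Hu n); exists g.
  rewrite -lee_fin (pE int_f ff').
  apply: (@ge0_fatou_bound _ _ _ _ _ (fun n x => `|u' n x|)) => //.
  + move=> n; have [/integrable_norm/measurable_int/measurable_EFinP] := u'P n.
    exact.
  + by have /integrable_norm/measurable_int/measurable_EFinP := int_f.
  (* The exceptional sets of countably many representatives are merged into one null set. *)
  + have uu' := ae_foralln (fun n => (u'P n).2).
    apply: filterS2 ff' uu' => x fx ux _; apply: cvg_norm; rewrite -fx//.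
    by under eq_fun => n do rewrite -(ux n I); exact: m_cvg.
  + by move=> n; have [int_u mu_] := u'P n; rewrite -(pE int_u mu_) lee_fin.
exists C => f Hf; apply: le_trans (CP f Hf).
have [f' int_f ff'] := m_int Hf.
have -> : \int[mu]_x m f x = \int[mu]_x f' x.
  congr fine; apply: ae_eq_integralr; first exact: measurable_int int_f.
  by apply: filterS ff' => x fx _; rewrite fx.
apply: le_trans (le_normr_Rintegral measurableT int_f) _.
by rewrite -lee_fin (pE int_f ff') fineK// (integrable_fin_num _ (integrable_norm int_f)).
Qed.

End IntegralFunctional.

(** * The sampling transform *)

Section Convolution.
Variables (R : realType) (Omega : set R).
Local Notation mu := (@lebesgue_measure R).
Implicit Types f g : Omega -> R[i].

Lemma conv_integrand_lin c f g h s x :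
  conv_integrand (c *: f + g) h s x =
  c * conv_integrand f h s x + conv_integrand g h s x.
Proof.
rewrite /conv_integrand mulrA -mulrDl; congr (_ * _) => /=.
(* Off [Omega] the extensions by 0 leave only [c * 0 + 0]. *)
by case: ('oinv_set_val x) => [t|] //=; rewrite mulr0 addr0.
Qed.

(** Passes from the convolution to the Borel representative given by [conv_exists], for which
    linearity of the integral is available. *)
Lemma cintegral_conv f h s (g : R -> R[i]) : cintegrable setT g ->
  conv_integrand f h s = g %[ae mu] -> convolution f h s = cintegral setT g.
Proof.
move=> [rg img] fg; apply: complex_eqP; congr fine; apply: ae_eq_integralr.
- exact: measurable_int rg.
- by apply: filterS fg => x /(_ I) ->.
- exact: measurable_int img.
- by apply: filterS fg => x /(_ I) ->.
Qed.

Lemma convolution_lin c f g h s : conv_exists f h s -> conv_exists g h s ->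
  convolution (c *: f + g) h s = c * convolution f h s + convolution g h s.
Proof.
move=> [f' int_f ff'] [g' int_g gg'].
have mT : measurable ([set: R] : set (measurableTypeR R)) by [].
have int_cf : cintegrable setT (fun x => c * f' x) by exact: cintegrableZl.
rewrite (cintegral_conv (g := fun x => c * f' x + g' x)).
- rewrite cintegralD// cintegralZl//.
  by rewrite (cintegral_conv int_f ff') (cintegral_conv int_g gg').
- exact: cintegrableD.
- by apply: filterS2 ff' gg' => x fx gx _; rewrite conv_integrand_lin fx// gx.
Qed.

End Convolution.

Section Sampling.
Variables (R : realType) (I Omega : set R).
Variables (phi : int -> R -> R[i]) (S : int -> Omega -> R[i]).
Hypothesis mI : measurable (I : set (measurableTypeR R)).
Hypothesis phi_onb : orthonormal_basis (L2 I) (@ipL2 R I) phi.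
Hypothesis S_fin : forall t,
  (\esum_(k in [set: int]) ((normc (S k t)) ^+ 2)%:E < +oo)%E.
Local Notation mu := (@lebesgue_measure R).
Local Notation ip := (@ipL2 R I).
Local Notation N := (ipnorm (@ipL2 R I)).
Local Notation T := (transform I phi S).
Local Notation K := (samp_kernel I phi S).

Let sip := L2_semi_inner_product mI.
Let phi_L2 k : L2 I (phi k). Proof. by case: phi_onb. Qed.
Let phi_orth k l : ip (phi k) (phi l) = (k == l)%:R.
Proof. by case: phi_onb. Qed.
Let phi_dense f : L2 I f -> forall eps : R, 0 < eps ->
  exists (A : {fset int}) (c : int -> R[i]), N (f - \sum_(k <- A) c k *: phi k) < eps.
Proof. by case: phi_onb => _ _; apply. Qed.

(** [K(., t)] is expanded along the conjugates of [phi], which are again orthonormal; with D2,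
    Riesz-Fischer then yields the kernel. *)
Let phic k : R -> R[i] := fun x => conjc (phi k x).
Let phic_L2 k : L2 I (phic k). Proof. exact: L2_conjc. Qed.

Lemma ipL2_conjc f g : L2 I f -> L2 I g ->
  ip (fun x => conjc (f x)) (fun x => conjc (g x)) = ip g f.
Proof. by move=> Lf Lg; apply: eq_cintegral => x _; rewrite conjcK mulrC. Qed.

Let phic_orth k l : ip (phic k) (phic l) = (k == l)%:R.
Proof. by rewrite ipL2_conjc// phi_orth eq_sym. Qed.

Lemma is_kernel_at_exists t : exists k, is_kernel_at I phi S t k.
Proof.
have [k Lk sum_k] := riesz_fischer sip (L2_complete mI) phic_L2 phic_orth (S_fin t).
by exists k; split.
Qed.

Let K_kernel t : is_kernel_at I phi S t (K t).
Proof. exact: xgetPex (is_kernel_at_exists t). Qed.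

Let K_L2 t : L2 I (K t). Proof. by case: (K_kernel t). Qed.

Let Kc t : R -> R[i] := fun x => conjc (K t x).
Let Kc_L2 t : L2 I (Kc t). Proof. exact: L2_conjc. Qed.

Lemma transform_ip F t : T F t = ip F (Kc t).
Proof. by apply: eq_cintegral => x _; rewrite conjcK. Qed.

(** Both sides, at [t], are the coefficient of [K(., t)] along the conjugate of [phi k]. *)
Lemma transform_phi k : T (phi k) = S k.
Proof.
apply/funext => t; have [_ sumK] := K_kernel t.
rewrite -(has_sum_coef sip phic_L2 phic_orth k (K_L2 t) sumK).
by apply: eq_cintegral => x _; rewrite conjcK mulrC.
Qed.

Lemma transform_lin c F G : L2 I F -> L2 I G -> T (c *: F + G) = c *: T F + T G.
Proof.
move=> LF LG; apply/funext => t.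
by rewrite transform_ip (ip_lin sip)// -!transform_ip.
Qed.

(** Evaluation at [t] is bounded, with constant [N (K t)]: this yields pointwise convergence of the
    integrands and, later, uniformity where [N (K t)] is bounded. *)
Lemma transform_le F t : L2 I F -> normc (T F t) <= N F * N (K t).
Proof.
move=> LF; rewrite transform_ip.
have -> : N (K t) = N (Kc t) by rewrite /ipnorm ipL2_conjc.
exact: (ip_cauchy_schwarz sip).
Qed.

Lemma ipnorm_eq0_ae F G : L2 I F -> L2 I G -> N (F - G) = 0 ->
  F = G %[ae mu in I].
Proof.
move=> LF LG /(ipnormL2_eq0 mI (subspaceB sip LF LG)).
by apply: filterS => x + Ix => /(_ Ix)/eqP; rewrite subr_eq0 => /eqP.
Qed.

Lemma transform_well_definedP : transform_well_defined I phi S.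
Proof.
split; first exact: is_kernel_at_exists.
move=> t k F G [Lk sum_k] LF LG FG.
have GK := L2_integrable_mul mI LG Lk; split => //.
have [_ sumK] := K_kernel t.
(* Two representatives of the sum of the same series differ by a null vector. *)
have Kk : K t = k %[ae mu in I].
  apply: ipnorm_eq0_ae => //.
  apply: (has_sum_unique sip _ (K_L2 t) Lk sumK sum_k) => j.
  exact: (subspaceZ sip (S j t) (phic_L2 j)).
apply: (ae_eq_cintegral mI).
- by apply: cintegrable_measurable; exact: L2_integrable_mul.
- exact: cintegrable_measurable.
- by apply: filterS2 FG Kk => x FGx Kkx Ix; rewrite FGx// Kkx.
Qed.

Variables (t_ : int -> Omega) (h : R -> R[i]) (a : int -> R[i]).
Hypothesis a_neq0 : forall k, a k != 0.
Hypothesis S_conv : forall k l,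
  convolution (S k) h (val (t_ l)) = a k * (k == l)%:R.
Hypothesis H_conv : forall F, L2 I F -> forall l, conv_exists (T F) h (val (t_ l)).

(** [m_le] bounds the integrand at each [x] by [N F] times a factor not known to be integrable in
    [x]. It gives convergence at every point; the bound on the integral comes from
    [integral_functional_bounded]. *)
Lemma conv_transform_bounded l : exists C : R, forall F, L2 I F ->
  normc (convolution (T F) h (val (t_ l))) <= C * N F.
Proof.
set s := val (t_ l).
pose m F x := conv_integrand (T F) h s x.
have m_lin c F G x : L2 I F -> L2 I G -> m (c *: F + G) x = c * m F x + m G x.
  by move=> LF LG; rewrite /m transform_lin// conv_integrand_lin.
have m_add F G x : L2 I F -> L2 I G -> m (F + G) x = m F x + m G x.
  by move=> LF LG; rewrite -[F in LHS]scale1r m_lin// mul1r.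
have m0 x : m 0 x = 0.
  have L0 := subspace0 sip; have := m_lin (-1) 0 0 x L0 L0.
  by rewrite scaler0 addr0 mulN1r addNr.
have m_scale c F x : L2 I F -> m (c *: F) x = c * m F x.
  by move=> LF; rewrite -[c *: F]addr0 m_lin ?m0 ?addr0//; exact: (subspace0 sip).
have m_le x : exists C, forall F, L2 I F -> normc (m F x) <= N F * C.
  rewrite /m /conv_integrand /=; case: ('oinv_set_val x) => [t|] /=.
    exists (N (K t) * normc (h (s - x))) => F LF.
    by rewrite normcM mulrA ler_wpM2r ?normc_ge0// transform_le.
  by exists 0 => F _; rewrite mul0r mulr0 normc_real normr0.
(* [r] stands for the real or the imaginary part, as the integral functionals above are real
   valued. *)
have part (r : R[i] -> R) : (forall z w, r (z + w) = r z + r w) ->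
    (forall (c : R) z, r ((c%:C)%C * z) = c * r z) ->
    (forall z, `|r z| <= normc z) ->
    (forall g, cintegrable setT g -> mu.-integrable setT (EFin \o (r \o g))) ->
    exists C, forall F, L2 I F -> `|\int[mu]_x r (m F x)| <= C * N F.
  move=> rD rZ r_le r_int.
  apply: (@integral_functional_bounded R _ _ _ sip (L2_complete mI) _
    (measurableTypeR R) mu (fun F x => r (m F x))).
  - by move=> F G LF LG x; rewrite m_add.
  - by move=> c F LF x; rewrite m_scale.
  - move=> F u LF Lu uF x; have [C CP] := m_le x.
    have rB n : `|r (m F x) - r (m (u n) x)| <= N (u n - F) * C.
      have LB := subspaceB sip (Lu n) LF.
      rewrite distrC (_ : r (m (u n) x) - r (m F x) = r (m (u n - F) x)).
        exact: le_trans (r_le _) (CP _ LB).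
      by rewrite -[in m (u n) x](subrK F (u n)) m_add// rD addrK.
    apply/cvgrPdist_le => eps eps0.
    have : (fun n => N (u n - F) * C) @ \oo --> 0 * C by apply: cvgMl.
    rewrite mul0r => /cvgrPdist_le/(_ _ eps0); apply: filterS => n.
    rewrite sub0r normrN => le_eps; apply: le_trans (rB n) (le_trans _ le_eps).
    exact: ler_norm.
  - move=> F LF; have [g int_g mg] := H_conv LF l.
    exists (r \o g); first exact: r_int.
    by apply: filterS mg => x mgx _; rewrite /= -mgx.
have [||C1 C1P] := part (@complex.Re R) (@ReD R) _ (@Re_le_normc R) _.
- by move=> c z; rewrite ReM mul0r subr0.
- by move=> g [].
have [||C2 C2P] := part (@complex.Im R) (@ImD R) _ (@Im_le_normc R) _.
- by move=> c z; rewrite ImM mul0r addr0.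
- by move=> g [].
exists (C1 + C2) => F LF; apply: le_trans (normc_le_ReIm _) _.
by rewrite mulrDl lerD ?C1P ?C2P.
Qed.

Lemma conv_transform l F : L2 I F ->
  convolution (T F) h (val (t_ l)) = a l * ip F (phi l).
Proof.
move=> LF; apply/eqP; rewrite -subr_eq0; apply/eqP.
have [C CP] := conv_transform_bounded l.
pose L F := convolution (T F) h (val (t_ l)) - a l * ip F (phi l).
rewrite -/(L F); apply: (bounded_functional_eq0 sip phi_L2 phi_dense
  (L := L) (C := C + normc (a l) * N (phi l))) => //.
- move=> c f g Lf Lg; rewrite /L transform_lin// convolution_lin//; try exact: H_conv.
  by rewrite (ip_lin sip)// mulrBr mulrDr opprD addrACA mulrCA.
- move=> f Lf; apply: le_trans (ler_normcD _ _) _.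
  rewrite normcN normcM mulrDl lerD ?CP// -mulrA ler_wpM2l ?normc_ge0// mulrC.
  exact: (ip_cauchy_schwarz sip).
(* On the basis [T (phi k)] is [S k], and D1 is what remains. *)
- move=> k; rewrite /L transform_phi S_conv phi_orth.
  case: (eqVneq k l) => [->|_]; first by rewrite subrr.
  by rewrite mulr0n !mulr0 subrr.
Qed.

(** The samples of [TF] are the [a_k F_k], and [a_k != 0], so they determine every coefficient of
    [F]. *)
Lemma transform_injectiveP : transform_injective I phi S.
Proof.
move=> F G LF LG TFG; apply: ipnorm_eq0_ae => //.
apply: (onb_complete sip phi_L2 phi_orth phi_dense); first exact: (subspaceB sip).
move=> k; rewrite (ipBl sip)//; apply/eqP; rewrite subr_eq0.
apply/eqP/(mulfI (a_neq0 k)).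
by rewrite -(conv_transform k LF) -(conv_transform k LG) TFG.
Qed.

Lemma transform_null F : L2 I F -> N F = 0 -> T F = 0.
Proof.
move=> LF NF0; apply/funext => t; apply/normc_eq0/eqP.
by rewrite eq_le normc_ge0 andbT; have := transform_le t LF; rewrite NF0 mul0r.
Qed.

(** The form on the range is defined from chosen preimages; injectivity makes each of them a.e.
    equal to the given one. *)
Lemma range_ip_transform F G : L2 I F -> L2 I G ->
  range_ip I phi S (T F) (T G) = ip F G.
Proof.
have pre E : L2 I E ->
    L2 I (preimage_of I phi S (T E)) /\ preimage_of I phi S (T E) = E %[ae mu in I].
  move=> LE; have [LP TP] : [set P | L2 I P /\ T P = T E] (preimage_of I phi S (T E)).
    by apply: xgetPex; exists E.
  by split => //; exact: transform_injectiveP.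
move=> LF LG; have [[LP PF] [LQ QG]] := (pre _ LF, pre _ LG).
apply: (ae_eq_cintegral mI).
- by apply: cintegrable_measurable; apply: L2_integrable_mul => //; exact: L2_conjc.
- by apply: cintegrable_measurable; apply: L2_integrable_mul => //; exact: L2_conjc.
- by apply: filterS2 PF QG => x PFx QGx Ix; rewrite PFx// QGx.
Qed.

(** A partial sum of the sampling series is [T] of a Fourier partial sum of [F], so the error is
    bounded by a factor independent of [t] times [N (K t)]. *)
Lemma transform_partial_sum F (A : {fset int}) t : L2 I F ->
  normc (T F t - \sum_(k <- A) convolution (T F) h (val (t_ k)) * (S k t / a k)) <=
  N (F - \sum_(k <- A) ip F (phi k) *: phi k) * N (K t).
Proof.
move=> LF.
have -> : T F t - \sum_(k <- A) convolution (T F) h (val (t_ k)) * (S k t / a k) =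
    T (F - \sum_(k <- A) ip F (phi k) *: phi k) t.
  rewrite !transform_ip (ipBl sip)//; last first.
    by apply: (subspace_sum sip) => k _; exact: (subspaceZ sip).
  congr (_ - _); rewrite (ip_suml sip) => [|k|//]; last exact: (subspaceZ sip).
  apply: eq_bigr => k _; rewrite conv_transform// (ipZl sip)// -transform_ip.
  by rewrite transform_phi; field.
apply: transform_le; apply: (subspaceB sip) => //.
by apply: (subspace_sum sip) => k _; exact: (subspaceZ sip).
Qed.

End Sampling.

Theorem theorem4p1 (R : realType) (I Omega : set R)
    (I_neq0 : I !=set0) (Omega_neq0 : Omega !=set0) (I_itv : is_interval I)
    (phi : int -> R -> R[i])
    (phi_onb : orthonormal_basis (L2 I) (@ipL2 R I) phi)
    (S : int -> Omega -> R[i]) (t_ : int -> Omega) (h : R -> R[i])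
    (h_L1 : cintegrable [set: R] h) (h_supp : compactly_supported h)
    (a : int -> R[i]) (a_neq0 : forall k, a k != 0)
    (D1 : forall k l, convolution (S k) h (val (t_ l)) = a k * (k == l)%:R)
    (D2 : forall t,
      (\esum_(k in [set: int]) ((normc (S k t)) ^+ 2)%:E < +oo)%E)
    (* the averages (f * h)(t_l) of the elements f = TF of the range exist *)
    (H_conv : forall F, L2 I F ->
      forall l, conv_exists (transform I phi S F) h (val (t_ l))) :
  let K := samp_kernel I phi S in
  let T := transform I phi S in
  let H := range_space I phi S in
  let ipH := range_ip I phi S in
  [/\ transform_well_defined I phi S,
      transform_injective I phi S,
      hilbert_space H ipH /\
      isometric_isomorphism (L2 I) (@ipL2 R I) H ipH T,
      orthonormal_basis H ipH S
    & forall f, H f ->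
      let term k t := convolution f h (val (t_ k)) * (S k t / a k) in
      (forall t, (fun A : {fset int} => normc (f t - \sum_(k <- A) term k t))
                   @ totally --> (0 : R)) /\
      (forall B : set Omega,
        (exists M : R, forall t, B t -> ipnorm (@ipL2 R I) (K t) <= M) ->
        (forall t, B t ->
          (\esum_(k in [set: int]) (normc (term k t))%:E < +oo)%E) /\
        (forall eps : R, 0 < eps -> \forall A \near totally,
          forall t, B t ->
            normc (f t - \sum_(k <- (A : {fset int})) term k t) < eps))].

Proof.
have mI : measurable (I : set (measurableTypeR R)) by exact: is_interval_measurable.
have sip := L2_semi_inner_product mI.
have [phi_L2 phi_orth phi_dense] := phi_onb.
move=> K T H ipH.
have T_lin := transform_lin mI phi_onb D2.
have T_null := transform_null mI phi_onb D2.
have T_iso := range_ip_transform mI phi_onb D2 a_neq0 D1 H_conv.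
split.
- exact: transform_well_definedP.
- exact: (transform_injectiveP mI phi_onb D2 a_neq0 D1 H_conv).
- split; first exact: (hilbert_isometric_image sip T_lin T_null T_iso (L2_complete mI)).
  by split.
- have := onb_isometric_image sip T_lin T_null T_iso phi_onb.
  by rewrite (_ : _ \o _ = S)//; apply/funext => k; exact: transform_phi.
move=> _ [F LF <-] term.
have sumF A t := transform_partial_sum mI phi_onb D2 a_neq0 D1 H_conv A t LF.
have /totally_cvg0P F_sum := has_sum_onb sip phi_L2 phi_orth phi_dense LF.
(* One finite set serves every [t] where the norm of [K t] is at most [M]. Taking [M] to be that
   norm at a single [t] gives pointwise convergence. *)
have approx (M eps : R) : 0 < eps -> exists A : {fset int}, forall B : {fset int},
    (A `<=` B)%fset -> forall t, ipnorm (@ipL2 R I) (K t) <= M ->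
    normc (T F t - \sum_(k <- B) term k t) < eps.
  move=> eps0; have M1 : 0 < `|M| + 1 by rewrite ltr_wpDl.
  have [A AP] := F_sum _ (divr_gt0 eps0 M1).
  exists A => B /AP; rewrite ger0_norm ?ipnorm_ge0// ltr_pdivlMr// => lt_eps t tM.
  apply: le_lt_trans (sumF B t) (le_lt_trans _ lt_eps).
  rewrite ler_wpM2l ?ipnorm_ge0// (le_trans tM)// (le_trans (ler_norm _))//.
  by rewrite lerDl.
split.
  move=> t; apply/totally_cvg0P => eps eps0.
  have [A AP] := approx (ipnorm (@ipL2 R I) (K t)) _ eps0.
  by exists A => B AB; rewrite ger0_norm ?normc_ge0//; exact: AP.
move=> B [M BM]; split; last first.
  move=> eps eps0; have [A AP] := approx M _ eps0.
  by exists A => // A' AA' t Bt; apply: AP => //; exact: BM.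
(* Once [a k] cancels, the terms are [F_k S_k(t)], bounded by [|F_k|^2 + |S_k(t)|^2]; Bessel
   controls the first sum and D2, through [M'], the second. *)
move=> t _; have [M' M'P] := esum_fin_bounded (fun k => sqr_ge0 _) (D2 t).
apply: (@le_lt_trans _ _ ((ipnorm (@ipL2 R I) F ^+ 2 + M')%:E)); last exact: ltry.
apply/esum_le_finP => A.
apply: (@le_trans _ _ (\sum_(k <- A)
    (normc (@ipL2 R I F (phi k)) ^+ 2 + normc (S k t) ^+ 2))).
  apply: ler_sum => k _.
  rewrite /term (conv_transform mI phi_onb D2 D1 H_conv k LF).
  rewrite [a k * _]mulrC -mulrA [a k * _]mulrCA mulfV// mulr1 normcM.
  have := normc_ge0 (S k t); have := normc_ge0 (@ipL2 R I F (phi k)).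
  move: (normc _) (normc _) => x y x0 y0; nra.
rewrite big_split lerD//.
exact: (bessel sip phi_L2 phi_orth).
Qed.
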